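(* Let $(M,g)$ be a Riemannian manifold and let $G$ be a Lie subgroup of the group of conformal automorphisms of $(M,g)$. For $\alpha\in G$ let $u_\alpha\in C^\infty(M,\mathbb{R}^{>0})$ be the function with $\alpha^*g=u_\alpha\cdot g$, and define $\lambda_{\mathrm{Conf}}:G\to C^\infty(M,\mathbb{R}^{>0})$ by $\lambda_{\mathrm{Conf}}(\alpha)(x)=u_\alpha(\alpha^{-1}x)$. Then: (1) $\lambda_{\mathrm{Conf}}$ is a differentiable one-cocycle, and its class $$\mu_{\mathrm{Conf}}=[\lambda_{\mathrm{Conf}}]\in H^1_d\left(G,C^\infty(M,\mathbb{R}^{>0})\right)$$ is induced by the conformal structure on $M$, i.e. it depends only on the conformal class of $g$. (2) The class $\mu_{\mathrm{Conf}}$ vanishes if and only if there exists a Riemannian metric $h$ conformal to $g$ such that $G$ is contained in the group of isometries $\mathrm{Iso}(M,h)$.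
   Context: A diffeomorphism $\alpha:M\to M$ is a conformal automorphism of $(M,g)$ if $\alpha^*g=u_\alpha\cdot g$ for some $u_\alpha\in C^\infty(M,\mathbb{R}^{>0})$. A metric $h$ is conformal to $g$ if $h=v\cdot g$ with $v\in C^\infty(M,\mathbb{R}^{>0})$. $C^\infty(M,\mathbb{R}^{>0})$ is the multiplicative group of positive smooth functions with the $C^\infty$-topology and $G$-action $(\alpha\cdot f)(x)=f(\alpha^{-1}x)$; via $\exp$ it is isomorphic to the differentiable $G$-module $C^\infty(M,\mathbb{R})$. A differentiable one-cocycle (crossed homomorphism) is a smooth map $\lambda:G\to C^\infty(M,\mathbb{R}^{>0})$ with $\lambda(\alpha\beta)(x)=\lambda(\beta)(\alpha^{-1}x)\cdot\lambda(\alpha)(x)$. $H^1_d(G,C^\infty(M,\mathbb{R}^{>0}))$ is the group of differentiable one-cocycles modulo those of the form $\lambda(\alpha)(x)=v(\alpha^{-1}x)\,v(x)^{-1}$ with $v\in C^\infty(M,\mathbb{R}^{>0})$. *)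

(* Defs.v *)
From HB Require Import structures.
From mathcomp Require Import all_boot all_order all_algebra.
From mathcomp Require Import all_classical all_reals all_analysis.
From mathcomp Require Import ring.
Import Order.TTheory GRing.Theory Num.Theory.
Import numFieldNormedType.Exports.

Set Implicit Arguments.
Unset Strict Implicit.
Unset Printing Implicit Defensive.

Local Open Scope classical_set_scope.
Local Open Scope ring_scope.

(* The library declares the normed module of matrices but not this weaker join. *)
HB.instance Definition _ (R : numFieldType) (m n : nat) :=
  PreTopologicalLmodule.copy (matrix R m n) (matrix R m n : normedModType R).

Section Smooth.
Context {R : realType} {n : nat} {E : preTopologicalLmodType R}.
Implicit Types (f : 'rV[R]_n -> E) (a : 'rV[R]_n) (i : 'I_n).

(* The library's [derivable] and ['D_v] require a normed codomain; the codomain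
   is only a topological vector space here because E will also be the Frechet
   space of smooth functions on a manifold. *)
Definition diff_quotient f i a : R -> E :=
  fun h => h^-1 *: (f (h *: delta_mx 0 i + a) - f a).

Definition pderivable f i a : Prop :=
  exists l : E, diff_quotient f i a h @[h --> 0^'] --> l.

Definition partial i f : 'rV[R]_n -> E :=
  fun a => xget 0 [set l | diff_quotient f i a h @[h --> 0^'] --> l].

Definition partials (s : seq 'I_n) f : 'rV[R]_n -> E := foldr partial f s.

(* C^infinity on U, meant for open U: all iterated partial derivatives exist
   and are continuous on U. *)
Definition smooth_on (U : set 'rV[R]_n) f : Prop :=
  forall (s : seq 'I_n) a, U a ->
    {for a, continuous (partials s f)} /\ forall i, pderivable (partials s f) i a.

End Smooth.

Record chart (R : realType) (n : nat) (T : topologicalType) := Chart {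
  chart_dom : set T ;
  chart_map : T -> 'rV[R]_n ;
  chart_inv : 'rV[R]_n -> T ;
  chart_img := chart_map @` chart_dom ;
  chart_dom_open : open chart_dom ;
  chart_img_open : open chart_img ;
  chart_mapK : forall x, chart_dom x -> chart_inv (chart_map x) = x ;
  chart_map_continuous : forall x, chart_dom x -> {for x, continuous chart_map} ;
  chart_inv_continuous : forall y, chart_img y -> {for y, continuous chart_inv}
}.

Record manifold (R : realType) (n : nat) (T : topologicalType) := Manifold {
  manifold_hausdorff : hausdorff_space T ;
  manifold_second_countable : @second_countable T ;
  atlas_index : Type ;
  atlas : atlas_index -> chart R n T ;
  atlas_cover : forall x, exists i, chart_dom (atlas i) x ;
  atlas_compatible : forall i j,
    smooth_on
      (chart_map (atlas i) @` (chart_dom (atlas i) `&` chart_dom (atlas j)))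
      (chart_map (atlas j) \o chart_inv (atlas i) : 'rV[R]_n -> 'rV[R]_n)
}.

Arguments atlas {R n T} m i.

Section SmoothMaps.
Context {R : realType}.

Definition smooth_map {m n} {S T : topologicalType}
    (A : manifold R m S) (B : manifold R n T) (f : S -> T) : Prop :=
  continuous f /\
  forall i j, let c := atlas A i in let d := atlas B j in
    smooth_on [set y | chart_img c y /\ chart_dom d (f (chart_inv c y))]
      (chart_map d \o f \o chart_inv c).

(* Smoothness of f : S x T -> V for the product manifold structure on S x T,
   whose charts are products of charts, valued in R^(m + n) *)
Definition smooth_map2 {m n p} {S T V : topologicalType}
    (A : manifold R m S) (B : manifold R n T) (C : manifold R p V)
    (f : S -> T -> V) : Prop :=
  continuous (fun z : S * T => f z.1 z.2) /\
  forall i j k, let c := atlas A i in let d := atlas B j in let e := atlas C k in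
    let F z := f (chart_inv c (lsubmx z)) (chart_inv d (rsubmx z)) in
    smooth_on
      [set z : 'rV[R]_(m + n) |
        [/\ chart_img c (lsubmx z), chart_img d (rsubmx z) & chart_dom e (F z)]]
      (chart_map e \o F).

Definition diffeomorphism {n} {T : topologicalType} (A : manifold R n T)
    (f : T -> T) : Prop :=
  exists h : T -> T,
    [/\ cancel f h, cancel h f, smooth_map A A f & smooth_map A A h].

(* W is meant to be open *)
Definition smooth_fun_on {n} {T : topologicalType} (A : manifold R n T)
    (W : set T) (f : T -> R) : Prop :=
  forall i, let c := atlas A i in
    smooth_on (chart_map c @` (chart_dom c `&` W))
      (f \o chart_inv c : 'rV[R]_n -> R).

Definition smooth_fun {n} {T : topologicalType} (A : manifold R n T)
    (f : T -> R) : Prop :=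
  smooth_fun_on A setT f.

Definition smooth_at {n} {T : topologicalType} (A : manifold R n T)
    (x : T) (f : T -> R) : Prop :=
  exists W : set T, [/\ open W, W x & smooth_fun_on A W f].

Definition pos_smooth {n} {T : topologicalType} (A : manifold R n T)
    : set (T -> R) :=
  [set f | smooth_fun A f /\ forall x, 0 < f x].

End SmoothMaps.

Section LinearClosure.
Context {R : realType} {n : nat}.
Implicit Types (f g : 'rV[R]_n -> R).

Lemma partialE f i a l :
  diff_quotient f i a h @[h --> 0^'] --> l -> partial i f a = l.
Proof.
move=> fl; apply: xget_unique => // l' fl'.
exact: (cvg_unique (@norm_hausdorff _ R^o) fl').
Qed.

Lemma diff_quotientP (k : R) f g i a (l l' : R) :
  diff_quotient f i a h @[h --> 0^'] --> l ->
  diff_quotient g i a h @[h --> 0^'] --> l' ->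
  diff_quotient (fun y => k * f y + g y) i a h @[h --> 0^'] --> k * l + l'.
Proof.
move=> fl gl.
have -> : diff_quotient (fun y => k * f y + g y) i a =
    (fun h => k * diff_quotient f i a h + diff_quotient g i a h).
  by apply/funext => h; rewrite /diff_quotient /GRing.scale /=; ring.
by apply: cvgD => //; apply: cvgMl_tmp.
Qed.

Lemma near_diff_quotient f g i a : (\forall y \near a, f y = g y) ->
  \forall h \near (0 : R)^', diff_quotient f i a h = diff_quotient g i a h.
Proof.
move=> fg; have fga := nbhs_singleton fg.
have sh : (fun h : R => h *: delta_mx 0 i + a) @ (0 : R)^' --> a.
  rewrite -[X in _ --> X]add0r -(scale0r (delta_mx 0 i)).
  apply: cvgD; last exact: cvg_cst.
  apply: cvgZr_tmp; apply: cvg_within_filter; exact: cvg_id.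
have := sh _ fg; rewrite !near_simpl => H.
near=> h; rewrite /diff_quotient fga; congr (_ *: (_ - _)).
by near: h.
Unshelve. all: by end_near. Qed.

Lemma cvg_diff_quotient_near f g i a (l : R) :
  (\forall y \near a, f y = g y) ->
  diff_quotient f i a h @[h --> 0^'] --> l ->
  diff_quotient g i a h @[h --> 0^'] --> l.
Proof.
move=> fg; apply: cvg_trans; apply: near_eq_cvg.
exact: near_diff_quotient.
Qed.

Lemma smooth_on_lin (U : set 'rV[R]_n) (k : R) f g : open U ->
  smooth_on U f -> smooth_on U g ->
  smooth_on U (fun y => k * f y + g y : R).
Proof.
move=> Uo fs gs; set F := fun y => _.
have lin s : forall a, U a ->
    partials s F a = k * partials s f a + partials s g a.
  elim: s => [//|i s IH] a Ua /=.
  have [_ /(_ i)[lf fl]] := fs s a Ua.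
  have [_ /(_ i)[lg gl]] := gs s a Ua.
  rewrite (partialE fl) (partialE gl); apply: partialE.
  apply: (cvg_diff_quotient_near _ (diff_quotientP fl gl)).
  by near=> y; rewrite IH//; near: y; exact: open_nbhs_nbhs.
have linE s a : U a -> \forall y \near a,
    k * partials s f y + partials s g y = partials s F y.
  by move=> Ua; near=> y; rewrite lin//; near: y; exact: open_nbhs_nbhs.
move=> s a Ua; have [fc fd] := fs s a Ua; have [gc gd] := gs s a Ua; split.
  rewrite /prop_for /continuous_at lin//; apply: cvg_trans.
    exact: near_eq_cvg (linE s a Ua).
  by apply: cvgD => //; apply: cvgMl_tmp.
move=> i; have [lf fl] := fd i; have [lg gl] := gd i.
by exists (k * lf + lg); apply: (cvg_diff_quotient_near _ (diff_quotientP fl gl));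
  exact: linE.
Unshelve. all: by end_near. Qed.

Lemma smooth_on_cst0 (U : set 'rV[R]_n) : smooth_on U (fun=> 0 : R).
Proof.
have dq0 i a : diff_quotient (fun=> 0 : R) i a h @[h --> 0^'] --> (0 : R).
  have -> : diff_quotient (fun=> 0 : R) i a = fun=> 0.
    by apply/funext => h; rewrite /diff_quotient subrr scaler0.
  exact: cvg_cst.
have p0 s : partials s (fun=> 0 : R) = (fun=> 0) :> ('rV[R]_n -> R).
  elim: s => [//|i s /= ->]; apply/funext => a; exact: partialE.
by move=> s a _; rewrite p0; split=> [|i]; [exact: cst_continuous|exists 0].
Qed.

End LinearClosure.

Section SmoothFunctions.
Context {R : realType} {n : nat} {T : topologicalType}.
Variable A : manifold R n T.

Definition smooth_pred : pred (T -> R) := fun f => `[< smooth_fun A f >].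

Lemma smooth_submod_closed : submod_closed smooth_pred.
Proof.
split=> [|k f g /asboolP fs /asboolP gs]; apply/asboolP => i /=.
  exact: smooth_on_cst0.
apply: smooth_on_lin (fs i) (gs i).
by rewrite setIT; exact: chart_img_open.
Qed.

HB.instance Definition _ :=
  GRing.isSubmodClosed.Build R (T -> R) smooth_pred
    (GRing.submod_closed_semi smooth_submod_closed).

Record Cinfty := MkCinfty {
  Cinfty_fun :> T -> R ;
  Cinfty_smooth : smooth_pred Cinfty_fun
}.

HB.instance Definition _ := [isSub for Cinfty_fun].
HB.instance Definition _ := [Choice of Cinfty by <:].
HB.instance Definition _ := [SubChoice_isSubLmodule of Cinfty by <:].

(* The C^infinity topology: uniform convergence on compact sets of all the
   partial derivatives in all the charts of the atlas. *)
Definition Cinfty_jet (f : Cinfty) :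
    prod_topology (fun p : atlas_index A * seq 'I_n =>
      {family [set K | compact K /\ K `<=` chart_img (atlas A p.1)],
         'rV[R]_n -> R}) :=
  fun p => partials p.2 (f \o chart_inv (atlas A p.1)).

HB.instance Definition _ :=
  Topological.copy Cinfty (initial_topology Cinfty_jet).

End SmoothFunctions.

Section Riemannian.
Context {R : realType} {n : nat} {T : topologicalType}.
Variable A : manifold R n T.

(* T_xM as the space of derivations of the algebra of germs of smooth functions
   at x.  A derivation is encoded as a functional on all functions, which is
   required to depend only on germs and to vanish on the functions that are not
   smooth near x, so that distinct functionals are distinct derivations. *)
Definition tangent (x : T) : set ((T -> R) -> R) :=
  [set v |
    [/\ forall (k : R) f f', smooth_at A x f -> smooth_at A x f' ->
          v (fun y => k * f y + f' y) = k * v f + v f',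
       forall f f', smooth_at A x f -> smooth_at A x f' ->
          v (fun y => f y * f' y) = v f * f' x + f x * v f',
       forall f f', (\forall y \near x, f y = f' y) -> v f = v f' &
       forall f, ~ smooth_at A x f -> v f = 0]].

Definition coord_vector (i : atlas_index A) (a : 'I_n) (x : T) :
    (T -> R) -> R :=
  fun f => if `[< smooth_at A x f >]
           then partial a (f \o chart_inv (atlas A i)) (chart_map (atlas A i) x)
           else 0.

Record riemannian_metric := RiemannianMetric {
  metric_val :> forall x : T, ((T -> R) -> R) -> ((T -> R) -> R) -> R ;
  metric_linear : forall x (k : R) v v' w,
    tangent x v -> tangent x v' -> tangent x w ->
    metric_val x (fun f => k * v f + v' f) w
      = k * metric_val x v w + metric_val x v' w ;
  metric_sym : forall x v w, tangent x v -> tangent x w ->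
    metric_val x v w = metric_val x w v ;
  metric_pos : forall x v, tangent x v -> v <> (fun=> 0) ->
    0 < metric_val x v v ;
  metric_smooth : forall i a b,
    smooth_fun_on A (chart_dom (atlas A i))
      (fun x => metric_val x (coord_vector i a x) (coord_vector i b x))
}.

Definition pushforward (alpha : T -> T) (v : (T -> R) -> R) : (T -> R) -> R :=
  fun f => v (f \o alpha).

Implicit Types (g h : riemannian_metric) (alpha : T -> T) (u : T -> R).

(* alpha^* g = u . g *)
Definition pullback_scales g alpha u : Prop :=
  forall x v w, tangent x v -> tangent x w ->
    g (alpha x) (pushforward alpha v) (pushforward alpha w) = u x * g x v w.

Definition conformal_automorphism g alpha : Prop :=
  diffeomorphism A alpha /\
  exists u, pos_smooth A u /\ pullback_scales g alpha u.

(* u_alpha; it is unique when dim M > 0 and alpha is a conformal automorphism *)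
Definition conformal_factor g alpha : T -> R :=
  xget (fun=> 1) [set u | pos_smooth A u /\ pullback_scales g alpha u].

Definition riemannian_isometry g alpha : Prop :=
  diffeomorphism A alpha /\ pullback_scales g alpha (fun=> 1).

Definition conformal_to h g : Prop :=
  exists v, pos_smooth A v /\
    forall x w w', tangent x w -> tangent x w' -> h x w w' = v x * g x w w'.

End Riemannian.

#[short(type="topGroupType")]
HB.structure Definition TopGroup := {G of Topological G & Group G}.

Record lieGroup (R : realType) (k : nat) := LieGroup {
  lie_sort :> topGroupType ;
  lie_manifold : manifold R k lie_sort ;
  lie_mul_smooth : smooth_map2 lie_manifold lie_manifold lie_manifold
                     (fun a b : lie_sort => (a * b)%g) ;
  lie_inv_smooth : smooth_map lie_manifold lie_manifold
                     (fun a : lie_sort => (a^-1)%g)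
}.

Section Cohomology.
Context {R : realType} {n : nat} {T : topologicalType} (A : manifold R n T).
Context {k : nat} (G : lieGroup R k) (act : G -> T -> T).

(* G, embedded in the diffeomorphisms of M by act, is an (immersed) Lie subgroup
   of the group of conformal automorphisms of (M, g). *)
Definition conformal_lie_subgroup (g : riemannian_metric A) : Prop :=
  [/\ forall x, act 1%g x = x,
      forall a b x, act (a * b)%g x = act a (act b x),
      injective act,
      smooth_map2 (lie_manifold G) A A act &
      forall a, conformal_automorphism g (act a)].

(* Smooth maps from G to C^infinity(M, R^{>0}), the latter being identified with
   the topological vector space C^infinity(M) by the isomorphism exp *)
Definition smooth_into_pos (lambda : G -> T -> R) : Prop :=
  exists L : G -> Cinfty A,
    (forall a x, lambda a x = expR (L a x)) /\
    forall i, let c := atlas (lie_manifold G) i in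
      smooth_on (chart_img c) (L \o chart_inv c).

Definition cocycle : set (G -> T -> R) :=
  [set lambda |
    [/\ forall a, pos_smooth A (lambda a),
        smooth_into_pos lambda &
        forall a b x,
          lambda (a * b)%g x = lambda b (act (a^-1)%g x) * lambda a x]].

Definition coboundary : set (G -> T -> R) :=
  [set lambda | exists v, pos_smooth A v /\
    forall a x, lambda a x = v (act (a^-1)%g x) * (v x)^-1].

(* The class of lambda in H^1_d(G, C^infinity(M, R^{>0})): its coset, in the
   group of cocycles under pointwise multiplication, modulo coboundaries *)
Definition cohomology_class (lambda : G -> T -> R) : set (G -> T -> R) :=
  [set mu | cocycle mu /\ coboundary (fun a x => mu a x / lambda a x)].

Definition trivial_class : set (G -> T -> R) := cohomology_class (fun _ _ => 1).

Definition lambda_Conf (g : riemannian_metric A) : G -> T -> R :=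
  fun a x => conformal_factor g (act a) (act (a^-1)%g x).

Definition mu_Conf (g : riemannian_metric A) : set (G -> T -> R) :=
  cohomology_class (lambda_Conf g).

End Cohomology.

(* Main.v *)
(* At a point x a metric g and its pullback are compared on a coordinate vector
   field d_0 near x:
     u_a(x) g_00(x) = sum_jl g_jl(a x) (d_0 a_j)(x) (d_0 a_l)(x).
   Since g_00 > 0, this determines u_a and shows that it is smooth jointly in
   (a, x).  Uniqueness gives u_(ab)(x) = u_a(b x) u_b(x), which is the cocycle
   identity and gives lambda_Conf(a) = 1 / u_(a^-1).  A function smooth jointly in
   (a, x) defines a smooth map a |-> f(a, .) to C^infinity(M): by compactness
   and the mean value theorem its difference quotients converge uniformly on
   compact sets, together with all partial derivatives in x.

   Replacing g by v g replaces u_a by v(a x) u_a(x) / v(x), that is, multiplies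
   lambda_Conf by the coboundary of 1 / v.  Hence the class is conformally
   invariant, and lambda_Conf is the coboundary of v exactly when all the factors
   of v g are equal to 1. *)
Require Import Defs.
From HB Require Import structures.
From mathcomp Require Import all_boot all_order all_algebra.
From mathcomp Require Import all_classical all_reals all_analysis.
From mathcomp Require Import ring.
Import Order.TTheory GRing.Theory Num.Theory.
Import numFieldNormedType.Exports.

Local Open Scope classical_set_scope.
Local Open Scope ring_scope.

(** * Smooth functions valued in a topological vector space *)

Section SmoothOn.
Context {R : realType} {n : nat} {E : preTopologicalLmodType R}.
Implicit Types (f g : 'rV[R]_n -> E) (U V : set 'rV[R]_n).

(** [smooth_on] asks for every iterated partial derivative, and its codomain may be C^infinity(M),
    where no total derivative is at hand. Explicit formulas for the iterated partials of a product,
    an inverse or a composite are avoided: smoothness is proved coinductively, by exhibiting a class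
    of continuous functions whose partial derivatives stay in the class. For real functions this is
    an algebra generated by derivatives; for maps to C^infinity(M) it consists of the maps
    represented by jointly smooth functions. The analytic core is the convergence of a difference
    quotient to the partial derivative when base point and step move together. It gives the chain
    rule, the symmetry of second partials and, through compactness, uniformity on compact sets.
    Symmetry is required because the topology of C^infinity(M) sees derivatives in x, which have to
    be interchanged with the derivative in the group parameter. The coordinate direction 0 is
    available because dim M > 0; it supplies the nonzero vector on which the conformal factor is
    read off. *)

Lemma cvg_line (a v : 'rV[R]_n) :
  (fun h : R => h *: v + a) @ (0 : R)^' --> a.
Proof.
rewrite -[X in _ --> X]add0r -(scale0r v).
apply: cvgD; last exact: cvg_cst.
apply: cvgZr_tmp; apply: cvg_within_filter; exact: cvg_id.
Qed.

Lemma near_eq_diff_quotient f g i a : (\forall y \near a, f y = g y) ->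
  \forall h \near (0 : R)^', diff_quotient f i a h = diff_quotient g i a h.
Proof.
move=> fg; have fga := nbhs_singleton fg.
have := cvg_line a (delta_mx 0 i) _ fg; rewrite !near_simpl => H.
near=> h; rewrite /diff_quotient fga; congr (_ *: (_ - _)).
by near: h.
Unshelve. all: by end_near. Qed.

Lemma near_eq_cvg_diff_quotient f g i a (l : E) :
  (\forall y \near a, f y = g y) ->
  diff_quotient f i a h @[h --> 0^'] --> l ->
  diff_quotient g i a h @[h --> 0^'] --> l.
Proof.
move=> fg; apply: cvg_trans; apply: near_eq_cvg.
exact: near_eq_diff_quotient.
Qed.

Lemma near_partial f g i a :
  (\forall y \near a, f y = g y) -> partial i f a = partial i g a.
Proof.
move=> fg; rewrite /partial; congr xget; apply/seteqP; split=> l /=;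
  apply: near_eq_cvg_diff_quotient => //.
by apply: filterS fg.
Qed.

Lemma near_partials s f g a :
  (\forall y \near a, f y = g y) -> partials s f a = partials s g a.
Proof.
elim: s a => [|i s IH] a /= fg; first exact: nbhs_singleton fg.
apply: near_partial; apply: filterS (nbhs_interior fg) => y; exact: IH.
Qed.

Lemma smooth_on_sub U V f : U `<=` V -> smooth_on V f -> smooth_on U f.
Proof. by move=> UV fs s a /UV; exact: fs. Qed.

Lemma eq_smooth_on U f g : open U -> (forall x, U x -> f x = g x) ->
  smooth_on U f -> smooth_on U g.
Proof.
move=> Uo fg fs s a Ua; have [fc fd] := fs s a Ua.
have fgn : \forall y \near a, partials s f y = partials s g y.
  have := open_nbhs_nbhs (conj Uo Ua); move=> /nbhs_interior; apply: filterS => y Uy.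
  by apply: near_partials; apply: filterS Uy.
split=> [|i].
  rewrite /prop_for /continuous_at -(nbhs_singleton fgn).
  by apply: cvg_trans fc; exact: (near_eq_cvg fgn).
by have [l fl] := fd i; exists l; apply: near_eq_cvg_diff_quotient fl.
Qed.

Lemma smooth_on_local U f :
  (forall x, U x -> exists V, V x /\ smooth_on V f) -> smooth_on U f.
Proof. by move=> loc s a /loc [V [Va fs]]; exact: fs. Qed.

Lemma smooth_on_continuous {U f} : smooth_on U f ->
  forall a, U a -> {for a, continuous f}.
Proof. by move=> fs a Ua; have [] := fs [::] a Ua. Qed.

Lemma smooth_on_partial {U f} i : smooth_on U f -> smooth_on U (partial i f).
Proof.
move=> fs s a Ua; suff -> : partials s (partial i f) = partials (rcons s i) f.
  exact: fs.
by rewrite /partials foldr_rcons.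
Qed.

Lemma smooth_on_partials {U f} s : smooth_on U f -> smooth_on U (partials s f).
Proof. by elim: s => //= i s IH /IH; exact: smooth_on_partial. Qed.

Hypothesis Ehaus : hausdorff_space E.

Lemma cvg_partial f i a (l : E) :
  diff_quotient f i a h @[h --> 0^'] --> l -> partial i f a = l.
Proof.
by move=> fl; apply: xget_unique => // l' fl'; exact: (cvg_unique Ehaus fl' fl).
Qed.

Lemma pderivableP f i a : pderivable f i a ->
  diff_quotient f i a h @[h --> 0^'] --> partial i f a.
Proof. by move=> [l fl]; rewrite (cvg_partial _ _ _ _ fl). Qed.

(** By induction on the word [s], the partial derivative of [f] along [s] agrees on [U] with some
    member of [C]. As [U] is open, agreement on [U] is agreement near each of its points, so members
    of [C] may behave arbitrarily off [U]. *)
Lemma smooth_on_coind U (C : set ('rV[R]_n -> E)) : open U ->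
  (forall f, C f -> forall a, U a -> {for a, continuous f}) ->
  (forall f i, C f -> exists2 f', C f' &
    forall a, U a -> diff_quotient f i a h @[h --> 0^'] --> f' a) ->
  forall f, C f -> smooth_on U f.
Proof.
move=> Uo Cc Cd f Cf.
have P s : exists2 f', C f' & forall a, U a -> partials s f a = f' a.
  elim: s => [|i s [f' Cf' ff']] /=; first by exists f.
  have [f'' Cf'' d] := Cd f' i Cf'; exists f'' => // a Ua.
  rewrite -(cvg_partial _ _ _ _ (d a Ua)); apply: near_partial.
  by apply: filterS (open_nbhs_nbhs (conj Uo Ua)).
move=> s a Ua; have [f' Cf' ff'] := P s.
have ffn : \forall y \near a, f' y = partials s f y.
  by apply: filterS (open_nbhs_nbhs (conj Uo Ua)) => y /ff'.
split=> [|i].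
  rewrite /prop_for /continuous_at ff'//.
  by apply: cvg_trans (Cc _ Cf' a Ua); exact: (near_eq_cvg ffn).
have [f'' _ d] := Cd f' i Cf'; exists (f'' a).
by apply: near_eq_cvg_diff_quotient (d a Ua).
Qed.

End SmoothOn.

(** * Difference quotients of real functions *)

Section RealCalculus.
Context {R : realType}.

Lemma hausdorff_real : hausdorff_space (R : preTopologicalLmodType R).
Proof. exact: (@norm_hausdorff _ R^o). Qed.

Section OneDomain.
Context {n : nat}.
Implicit Types (f g : 'rV[R]_n -> R) (i : 'I_n) (a z : 'rV[R]_n).

(** Restriction to a coordinate line makes the one-variable rules of differentiation available. The
    point [t] on the line is arbitrary because the mean value theorem needs derivatives along a
    whole segment. *)
Lemma is_derive_lineP f i a (t l : R) :
  diff_quotient f i (t *: delta_mx 0 i + a) h @[h --> 0^'] --> l <->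
  is_derive t 1 (fun s : R => f (s *: delta_mx 0 i + a)) l.
Proof.
have E : diff_quotient f i (t *: delta_mx 0 i + a) =
    fun h : R => h^-1 *: (((fun s : R => f (s *: delta_mx 0 i + a)) \o shift t)
      (h *: 1) - f (t *: delta_mx 0 i + a)).
  apply/funext => h; rewrite /diff_quotient /=; congr (_ *: (f _ - _)).
  by rewrite -[h *: 1]/(h * 1) mulr1 scalerDl addrA.
rewrite E; split=> [fl|[dv <-]]; last exact: dv.
apply: DeriveDef; first by apply/cvg_ex; exists l.
exact: (cvg_lim (@norm_hausdorff _ R^o) fl).
Qed.

Lemma is_derive_line0P f i a (l : R) :
  diff_quotient f i a h @[h --> 0^'] --> l <->
  is_derive (0 : R) 1 (fun s : R => f (s *: delta_mx 0 i + a)) l.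
Proof. by rewrite -is_derive_lineP scale0r add0r. Qed.

Lemma diff_quotientD f g i a (l l' : R) :
  diff_quotient f i a h @[h --> 0^'] --> l ->
  diff_quotient g i a h @[h --> 0^'] --> l' ->
  diff_quotient (fun y => f y + g y) i a h @[h --> 0^'] --> l + l'.
Proof.
move=> /is_derive_line0P fl /is_derive_line0P gl; exact/is_derive_line0P.
Qed.

Lemma diff_quotientM f g i a (l l' : R) :
  diff_quotient f i a h @[h --> 0^'] --> l ->
  diff_quotient g i a h @[h --> 0^'] --> l' ->
  diff_quotient (fun y => f y * g y) i a h @[h --> 0^'] --> l * g a + f a * l'.
Proof.
move=> /is_derive_line0P fl /is_derive_line0P gl; apply/is_derive_line0P.
apply: (is_derive_eq (is_deriveM fl gl)).
by rewrite scale0r add0r /GRing.scale /=; ring.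
Qed.

Lemma diff_quotient_cst (c : R) i a :
  diff_quotient (fun=> c) i a h @[h --> 0^'] --> (0 : R).
Proof. by apply/is_derive_line0P; exact: is_derive_cst. Qed.

Lemma diff_quotient_coord (j i : 'I_n) a :
  diff_quotient (fun y => y 0 j : R) i a h @[h --> 0^'] --> ((i == j)%:R : R).
Proof.
apply/is_derive_line0P; rewrite (_ : (fun s : R => _) =
  fun s => s * (i == j)%:R + a 0 j).
  by apply: is_derive_eq; rewrite scaler0 add0r addr0 /GRing.scale /= mulr1.
by apply/funext => s; rewrite !mxE eqxx/= eq_sym.
Qed.

Lemma diff_quotient_comp1 (p : R -> R) f i a (l l' : R) :
  is_derive (f a) 1 p l' -> diff_quotient f i a h @[h --> 0^'] --> l ->
  diff_quotient (p \o f) i a h @[h --> 0^'] --> l' * l.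
Proof.
move=> pl /is_derive_line0P fl; apply/is_derive_line0P.
apply: (@is_derive1_comp _ p (fun s : R => f (s *: delta_mx 0 i + a))) => //.
by rewrite scale0r add0r.
Qed.

(** Stated with absolute values so as to cover steps [h] of both signs, as two-sided difference
    quotients demand. *)
Lemma mean_value (p dp : R -> R) (h : R) :
  (forall t : R, `|t| <= `|h| -> is_derive t 1 p (dp t)) ->
  exists2 c, `|c| <= `|h| & p h - p 0 = dp c * h.
Proof.
move=> pd.
have cont (x y : R) : (forall t, t \in `[x, y] -> `|t| <= `|h|) ->
    {within `[x, y], continuous p}.
  by move=> xy; apply: derivable_within_continuous => t /xy /pd[].
have [h0|h0] := leP 0 h.
  have sub t : t \in `[0, h] -> `|t| <= `|h|.
    by rewrite in_itv/= => /andP[? ?]; rewrite !ger0_norm.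
  have [t /subset_itv_oo_cc/sub/pd//|c /sub ch ->] :=
      @MVT_segment _ p dp _ _ h0 _ (cont _ _ sub).
  by exists c => //; rewrite subr0.
have sub t : t \in `[h, 0] -> `|t| <= `|h|.
  by rewrite in_itv/= => /andP[? ?]; rewrite !ler0_norm ?lerN2// ltW.
have [t /subset_itv_oo_cc/sub/pd//|c /sub ch E] :=
  @MVT_segment _ p dp _ _ (ltW h0) _ (cont _ _ sub).
by exists c => //; rewrite -opprB E sub0r mulrN opprK.
Qed.

(** The difference quotient with its singularity at [h = 0] filled in by the partial derivative.
    Hence [slopeE] holds for every [h], and the chain rule can use increments that happen to
    vanish. *)
Definition slope f i (z : 'rV[R]_n) (h : R) : R :=
  if h == 0 then partial i f z else diff_quotient f i z h.

Lemma slopeE f i z h : f (h *: delta_mx 0 i + z) - f z = h * slope f i z h.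
Proof.
rewrite /slope; have [->|h0] := eqVneq h 0.
  by rewrite scale0r add0r subrr mul0r.
by rewrite /diff_quotient /GRing.scale /= mulrA divff// mul1r.
Qed.

Lemma slope_mean_value f i z h :
  (forall t, `|t| <= `|h| -> pderivable f i (t *: delta_mx 0 i + z)) ->
  exists2 c, `|c| <= `|h| & slope f i z h = partial i f (c *: delta_mx 0 i + z).
Proof.
move=> fd; rewrite /slope; have [->|h0] := eqVneq h 0.
  by exists 0 => //; rewrite scale0r add0r.
have [t /fd|c ch E] := @mean_value (fun s : R => f (s *: delta_mx 0 i + z))
    (fun s => partial i f (s *: delta_mx 0 i + z)) h.
  by move=> /(pderivableP hausdorff_real)/is_derive_lineP.
exists c => //; rewrite /diff_quotient.
by move: E; rewrite scale0r add0r => ->; rewrite /GRing.scale /= mulrC mulfK.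
Qed.

(** Continuity of [t *: v + z] at [(z0, 0)], with the neighbourhood of 0 shrunk to a ball. It puts
    the whole segment on which the mean value theorem is applied inside [P]. *)
Lemma near_segment (P : set 'rV[R]_n) z0 (v : 'rV[R]_n) : nbhs z0 P ->
  \forall p \near (z0, 0 : R), forall t, `|t| <= `|p.2| -> P (t *: v + p.1).
Proof.
move=> Pz0.
have : (fun p : 'rV[R]_n * R => p.2 *: v + p.1) @ (z0, 0 : R) --> z0.
  rewrite -[X in _ --> X]add0r -(scale0r v).
  by apply: cvgD; [apply: cvgZr_tmp; exact: cvg_snd|exact: cvg_fst].
move=> /(_ _ Pz0); rewrite !near_simpl => -[[A B]] /= [Az B0] AB.
have [r /= r0 rB] := (nbhs_ballP _ _).1 B0.
exists (A, ball (0 : R) r) => /=; first by split => //; exact: nbhsx_ballx.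
move=> [z h] /= [Az1]; rewrite /ball/= sub0r normrN => hr t th.
apply: (AB (z, t)); split => //=; apply: rB.
by rewrite /ball/= sub0r normrN; exact: le_lt_trans hr.
Qed.

(** By the mean value theorem a slope is a value of [partial i f] at a nearby point, so continuity
    of that partial lets the base point and the step vary simultaneously. *)
Lemma slope_cvg f i z0 : (\forall z \near z0, pderivable f i z) ->
  {for z0, continuous (partial i f)} ->
  slope f i p.1 p.2 @[p --> (z0, 0 : R)] --> partial i f z0.
Proof.
move=> fd fc; apply/cvgrPdist_lt => e e0.
have /cvgrPdist_lt/(_ e e0) fe := fc.
apply: (filterS _ (near_segment _ _ (delta_mx 0 i) (filterI fd fe))) => -[z h] /= H.
have [|c /H[_ ? ->//]] := slope_mean_value f i z h.
by move=> t /H[].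
Qed.

Lemma diff_quotient_shift f i (v : 'rV[R]_n) a :
  diff_quotient (fun z => f (v + z)) i a = diff_quotient f i (v + a).
Proof. by apply/funext => h; rewrite /diff_quotient addrCA. Qed.

(* Symmetry of second derivatives: by the mean value theorem, the quotient in
   direction j of z |-> diff_quotient f i z h is a slope of [partial j f]. *)
Lemma partial_comm (U : set 'rV[R]_n) f i j a : open U -> smooth_on U f ->
  U a -> partial i (partial j f) a = partial j (partial i f) a.
Proof.
move=> Uo fs Ua; have nU : nbhs a U by exact: open_nbhs_nbhs.
have fd k z : U z -> diff_quotient f k z h @[h --> 0^'] --> partial k f z.
  by move=> /(fs [::])[_ ?]; exact: (pderivableP hausdorff_real).
have jfs := smooth_on_partial j fs.
apply/esym/(cvg_partial hausdorff_real)/cvgrPdist_le => e e0.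
have : slope (partial j f) i p.1 p.2 @[p --> (a, 0 : R)] -->
    partial i (partial j f) a.
  apply: slope_cvg; first by apply: filterS nU => z /(jfs [::])[].
  exact: (smooth_on_continuous (smooth_on_partial i jfs)).
move=> /cvgrPdist_le/(_ e e0) ne.
have [[A B] /= [Aa B0] AB] := filterI ne (near_segment _ _ (delta_mx 0 i) nU).
have [[C D] /= [Ca D0] CD] := near_segment _ _ (delta_mx 0 j) (filterI Aa nU).
have nD : \forall l \near (0 : R)^', D l by exact: cvg_within.
near=> l; have l0 : l != 0 by near: l; exact: nbhs_dnbhs_neq.
have lAU t : `|t| <= `|l| -> (A `&` U) (t *: delta_mx 0 j + a).
  move=> tl; apply: (CD (a, l)) => //; split => /=; first exact: nbhs_singleton.
  by near: l.
have Ul : U (l *: delta_mx 0 j + a) by have [] := lAU l (lexx _).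
(* The step [l] is fixed and [h] tends to 0: the doubly divided difference tends to the quotient of
   [partial i f] in direction [j]. A non-strict bound by [e], valid for all small [h], therefore
   survives the limit. *)
have lim2 : `|partial i (partial j f) a -
    l^-1 * (diff_quotient f i (l *: delta_mx 0 j + a) h -
    diff_quotient f i a h)| @[h --> (0 : R)^'] -->
    `|partial i (partial j f) a - diff_quotient (partial i f) j a l|.
  apply: cvg_norm; apply: cvgB; first exact: cvg_cst.
  by apply: cvgMl_tmp; apply: cvgB; exact: fd.
apply: (closed_cvg _ (@closed_le _ e) _ _ lim2).
have nB : \forall h \near (0 : R)^', B h by exact: cvg_within.
near=> h; have h0 : h != 0 by near: h; exact: nbhs_dnbhs_neq.
have hAB z : A z -> `|partial i (partial j f) a - slope (partial j f) i z h| <= e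
    /\ U (h *: delta_mx 0 i + z).
  move=> Az; have [|? Uh] := AB (z, h); first by split => //=; near: h.
  by split => //; exact: Uh.
pose F z := diff_quotient f i z h.
have Fd z : A z -> U z ->
    diff_quotient F j z t @[t --> 0^'] --> slope (partial j f) i z h.
  move=> Az Uz; have [_ Uhz] := hAB _ Az.
  have -> : F = fun y => h^-1 * f (h *: delta_mx 0 i + y) + - h^-1 * f y.
    by apply/funext => y; rewrite /F /diff_quotient /GRing.scale /= mulrBr mulNr.
  have -> : slope (partial j f) i z h =
      h^-1 * partial j f (h *: delta_mx 0 i + z) + - h^-1 * partial j f z.
    by rewrite /slope (negbTE h0) /diff_quotient /GRing.scale /= mulrBr mulNr.
  have fv : diff_quotient (fun y => f (h *: delta_mx 0 i + y)) j z t
      @[t --> 0^'] --> partial j f (h *: delta_mx 0 i + z).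
    by rewrite diff_quotient_shift; exact: fd.
  have fz : diff_quotient (fun y => - h^-1 * f y) j z t
      @[t --> 0^'] --> - h^-1 * partial j f z.
    have := diff_quotientM _ _ _ _ _ _ (diff_quotient_cst (- h^-1) j z) (fd j z Uz).
    by rewrite mul0r add0r.
  exact: diff_quotientP fv fz.
have [|c cl] := slope_mean_value F j a l.
  by move=> t /lAU[At Ut]; exists (slope (partial j f) i (t *: delta_mx 0 j + a) h);
    exact: Fd.
have [Ac Uc] := lAU c cl.
rewrite (cvg_partial hausdorff_real _ _ _ _ (Fd _ Ac Uc)) /slope (negbTE l0).
rewrite /F {1}/diff_quotient {1}/GRing.scale /= => ->.
by have [] := hAB _ Ac.
Unshelve. all: by end_near. Qed.

End OneDomain.
End RealCalculus.

(** * Chain rule and closure properties of smooth functions *)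

Lemma cvg_sum {R : realType} {V : normedModType R} {T : Type}
    (F : set_system T) {FF : Filter F} {I : Type} (r : seq I) (P : pred I)
    (f : I -> T -> V) (l : I -> V) :
  (forall j, P j -> f j x @[x --> F] --> l j) ->
  \sum_(j <- r | P j) f j x @[x --> F] --> \sum_(j <- r | P j) l j.
Proof. by move=> fl; apply: (cvg_big add_continuous). Qed.

Section Chain.
Context {R : realType} {m n : nat}.

(** Only derivatives of [f] along coordinate directions are available, so the increment of [f] is
    telescoped along a path of coordinate steps. The base points of these steps move with [h], which
    is where the joint limit [slope_cvg] enters. *)
Lemma chain_rule (f : 'rV[R]_m -> R) (phi : 'rV[R]_n -> 'rV[R]_m) (i : 'I_n)
    (a : 'rV[R]_n) (dphi : 'I_m -> R) :
  (forall j, \forall y \near phi a, pderivable f j y) ->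
  (forall j, {for phi a, continuous (partial j f)}) ->
  (forall j, diff_quotient (fun z => phi z 0 j : R) i a h @[h --> 0^'] --> dphi j) ->
  diff_quotient (f \o phi) i a h @[h --> 0^']
    --> \sum_j dphi j * partial j f (phi a).
Proof.
move=> fd fc dphiP.
pose D (j : 'I_m) (h : R) : R := phi (h *: delta_mx 0 i + a) 0 j - phi a 0 j.
(* [p k h] moves the first k coordinates of [phi a] to those of
   [phi (h *: delta_mx 0 i + a)], one direction at a time. *)
pose p (k : nat) (h : R) := \sum_(l < m | (l < k)%N) D l h *: delta_mx 0 l + phi a.
have D0 j : D j h @[h --> 0^'] --> (0 : R).
  have : h * diff_quotient (fun z => phi z 0 j : R) i a h @[h --> (0 : R)^'] -->
      0 * dphi j.
    by apply: cvgM => //; apply: cvg_within_filter; exact: cvg_id.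
  rewrite mul0r; apply: cvg_trans; apply: near_eq_cvg; near=> h.
  rewrite /diff_quotient /GRing.scale /= mulrA divff ?mul1r//.
  by near: h; exact: nbhs_dnbhs_neq.
have pc k : p k h @[h --> 0^'] --> phi a.
  have : \sum_(l < m | (l < k)%N) D l h *: delta_mx 0 l @[h --> (0 : R)^'] -->
      (\sum_(l < m | (l < k)%N) 0 *: delta_mx 0 l : 'rV[R]_m).
    by apply: cvg_sum => l _; apply: cvgZr_tmp; exact: D0.
  rewrite [X in _ --> X]big1 => [pc|l _]; last by rewrite scale0r.
  by rewrite -[X in _ --> X]add0r; apply: cvgD pc _; exact: cvg_cst.
have p0 h : p 0%N h = phi a by rewrite /p big_pred0 ?add0r.
have pm h : p m h = phi (h *: delta_mx 0 i + a).
  rewrite /p (eq_bigl xpredT) => [|l]; last by rewrite ltn_ord.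
  apply/rowP => j; rewrite mxE summxE (bigD1 j)//= big1 ?addr0 => [|l lj].
    by rewrite !mxE !eqxx mulr1 subrK.
  by rewrite !mxE eqxx eq_sym (negbTE lj) mulr0.
have pS (j : 'I_m) h : p j.+1 h = D j h *: delta_mx 0 j + p j h.
  rewrite /p (bigD1 j)//= addrA; congr (_ + _ + _); apply: eq_bigl => l.
  by rewrite ltnS [RHS]ltn_neqAle andbC.
(* An exact identity for every [h]: [slope] absorbs the steps with [D j h = 0], where an ordinary
   quotient would lose the factor. *)
have E : diff_quotient (f \o phi) i a = fun h => \sum_j
    diff_quotient (fun z => phi z 0 j : R) i a h * slope f j (p j h) (D j h).
  apply/funext => h; rewrite /diff_quotient /= -pm -(p0 h).
  rewrite -(telescope_sumr (fun k => f (p k h)))// big_mkord scaler_sumr.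
  apply: eq_bigr => j _; rewrite pS slopeE p0 pm.
  by rewrite /D /GRing.scale /= mulrA.
rewrite E; apply: (@cvg_sum R R^o) => j _.
apply: cvgM => //.
have := slope_cvg f j (phi a) (fd j) (fc j).
have pD : (p j h, D j h) @[h --> (0 : R)^'] --> (phi a, 0 : R).
  exact: cvg_pair (pc j) (D0 j).
by move=> sc; apply: (cvg_comp _ _ pD sc).
Unshelve. all: by end_near. Qed.

Lemma chain_rule_smooth (f : 'rV[R]_m -> R) (phi : 'rV[R]_n -> 'rV[R]_m)
    (V : set 'rV[R]_m) (i : 'I_n) (a : 'rV[R]_n) :
  open V -> smooth_on V f -> V (phi a) ->
  (forall j, pderivable (fun z => phi z 0 j : R) i a) ->
  diff_quotient (f \o phi) i a h @[h --> 0^']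
    --> \sum_j partial i (fun z => phi z 0 j : R) a * partial j f (phi a).
Proof.
move=> Vo fs Va phid; apply: chain_rule => j.
- by apply: filterS (open_nbhs_nbhs (conj Vo Va)) => y /(fs [::])[].
- exact: (smooth_on_continuous (smooth_on_partial j fs)).
- exact: (pderivableP hausdorff_real).
Qed.

End Chain.

Section Algebra.
Context {R : realType} {n : nat}.
Implicit Types (f g : 'rV[R]_n -> R) (U : set 'rV[R]_n) (S : set ('rV[R]_n -> R)).

Inductive alg_gen S : set ('rV[R]_n -> R) :=
| alg_of f : S f -> alg_gen S f
| alg_cst c : alg_gen S (fun=> c)
| alg_add f g : alg_gen S f -> alg_gen S g -> alg_gen S (fun x => f x + g x)
| alg_mul f g : alg_gen S f -> alg_gen S g -> alg_gen S (fun x => f x * g x).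

Lemma alg_sum S m (F : 'I_m -> 'rV[R]_n -> R) :
  (forall j, alg_gen S (F j)) -> alg_gen S (fun x => \sum_j F j x).
Proof.
elim: m F => [|m IH] F FS.
  rewrite (_ : (fun _ => _) = fun=> 0); first exact: alg_cst.
  by apply/funext => x; rewrite big_ord0.
rewrite (_ : (fun _ => _) = fun x => F ord0 x + \sum_j F (lift ord0 j) x).
  by apply: alg_add => //; exact: IH.
by apply/funext => x; rewrite big_ord_recl.
Qed.

(** The Leibniz rule keeps derivatives of sums and products inside the generated algebra, so only
    generators have to be examined. Their derivatives may be polynomials in generators rather than
    generators. *)
Lemma alg_smooth_on U S : open U ->
  (forall f, S f -> forall a, U a -> {for a, continuous f}) ->
  (forall f i, S f -> exists2 f', alg_gen S f' &
    forall a, U a -> diff_quotient f i a h @[h --> 0^'] --> f' a) ->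
  forall f, alg_gen S f -> smooth_on U f.
Proof.
move=> Uo Sc Sd; apply: (smooth_on_coind hausdorff_real) => //.
  move=> f Af a Ua; elim: Af => [g /Sc|c|g g' _ gc _ g'c|g g' _ gc _ g'c].
  - exact.
  - exact: cst_continuous.
  - exact: continuousD.
  - exact: continuousM.
move=> f i; elim=> [g /Sd//|c|g g' Ag [dg Adg dgP] Ag' [dg' Adg' dg'P]
    |g g' Ag [dg Adg dgP] Ag' [dg' Adg' dg'P]].
- by exists (fun=> 0) => [|a Ua]; [exact: alg_cst|exact: diff_quotient_cst].
- exists (fun x => dg x + dg' x) => [|a Ua]; first exact: alg_add.
  by apply: diff_quotientD; [exact: dgP|exact: dg'P].
- exists (fun x => dg x * g' x + g x * dg' x) => [|a Ua].
    by apply: alg_add; exact: alg_mul.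
  by apply: diff_quotientM; [exact: dgP|exact: dg'P].
Qed.

Definition all_partials f : set ('rV[R]_n -> R) := [set partials s f | s in setT].

Lemma all_partials_closed {U f} i {g} : smooth_on U f -> all_partials f g ->
  exists2 g', all_partials f g' &
    forall a, U a -> diff_quotient g i a h @[h --> 0^'] --> g' a.
Proof.
move=> fs [s _ <-]; exists (partials (i :: s) f); first by exists (i :: s).
by move=> a /(fs s)[_ /(_ i)]; exact: (pderivableP hausdorff_real).
Qed.

Lemma all_partials_continuous {U f g} : smooth_on U f -> all_partials f g ->
  forall a, U a -> {for a, continuous g}.
Proof. by move=> fs [s _ <-] a /(fs s)[]. Qed.

Lemma smooth_on_cst U (c : R) : open U -> smooth_on U (fun=> c).
Proof.
move=> Uo; apply: (@alg_smooth_on U set0) => //; exact: alg_cst.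
Qed.

Lemma smooth_on_coord U (j : 'I_n) : open U -> smooth_on U (fun x => x 0 j : R).
Proof.
move=> Uo; apply: (@alg_smooth_on U [set (fun x : 'rV[R]_n => x 0 j : R)]) => //.
- by move=> _ -> a _; exact: coord_continuous.
- move=> _ i ->; exists (fun=> (i == j)%:R); first exact: alg_cst.
  by move=> a _; exact: diff_quotient_coord.
- exact: alg_of.
Qed.

Lemma smooth_on_gen2 {U f g} (h : 'rV[R]_n -> R) : open U ->
  smooth_on U f -> smooth_on U g ->
  alg_gen (all_partials f `|` all_partials g) h -> smooth_on U h.
Proof.
move=> Uo fs gs; apply: alg_smooth_on => // k.
  by move=> [/(all_partials_continuous fs)|/(all_partials_continuous gs)].
move=> i [/(all_partials_closed i fs)|/(all_partials_closed i gs)] [k' kk' dk'].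
  by exists k' => //; apply: alg_of; left.
by exists k' => //; apply: alg_of; right.
Qed.

Lemma smooth_onD {U f g} : open U -> smooth_on U f -> smooth_on U g ->
  smooth_on U (fun x => f x + g x : R).
Proof.
move=> Uo fs gs; apply: (smooth_on_gen2 _ Uo fs gs).
by apply: alg_add; apply: alg_of; [left|right]; exists [::].
Qed.

Lemma smooth_onM {U f g} : open U -> smooth_on U f -> smooth_on U g ->
  smooth_on U (fun x => f x * g x : R).
Proof.
move=> Uo fs gs; apply: (smooth_on_gen2 _ Uo fs gs).
by apply: alg_mul; apply: alg_of; [left|right]; exists [::].
Qed.

Lemma smooth_on_sum U m (F : 'I_m -> 'rV[R]_n -> R) : open U ->
  (forall j, smooth_on U (F j)) -> smooth_on U (fun x => \sum_j F j x : R).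
Proof.
move=> Uo; elim: m F => [|m IH] F Fs.
  rewrite (_ : (fun _ => _) = fun=> 0); first exact: smooth_on_cst.
  by apply/funext => x; rewrite big_ord0.
rewrite (_ : (fun _ => _) = fun x => F ord0 x + \sum_j F (lift ord0 j) x).
  by apply: smooth_onD => //; exact: IH.
by apply/funext => x; rewrite big_ord_recl.
Qed.

Lemma is_derive_inv (x : R) : x != 0 ->
  is_derive x 1 (fun y : R => y^-1) (- (x^-1 * x^-1)).
Proof.
move=> x0; apply: is_derive_eq; first exact: (is_deriveV x0).
by rewrite /GRing.scale /= mulr1 expr2 invfM.
Qed.

Lemma smooth_onV {U f} : open U -> smooth_on U f -> (forall x, U x -> f x != 0) ->
  smooth_on U (fun x => (f x)^-1 : R).
Proof.
move=> Uo fs f0.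
(* One new generator suffices, since the derivative of [1 / f] is a polynomial in [1 / f] and a
   partial of [f]. *)
apply: (@alg_smooth_on U (all_partials f `|` [set fun x => (f x)^-1])) => //.
- move=> g [/(all_partials_continuous fs) gc|->] a; first exact: gc.
  move=> Ua.
  exact: (@cvgV R _ _ _ f (f a) (f0 a Ua) (smooth_on_continuous fs a Ua)).
- move=> g i [/(all_partials_closed i fs)[g' ? ?]|->].
    by exists g' => //; apply: alg_of; left.
  exists (fun x => - 1 * ((f x)^-1 * (f x)^-1) * partial i f x).
    apply: alg_mul; last by apply: alg_of; left; exists [:: i].
    by apply: alg_mul; [exact: alg_cst|apply: alg_mul; apply: alg_of; right].
  move=> a Ua; rewrite mulN1r.
  apply: (diff_quotient_comp1 (fun y => y^-1) f); first exact/is_derive_inv/f0.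
  by apply: (pderivableP hausdorff_real); have [_] := fs [::] a Ua; exact.
- by apply: alg_of; right.
Qed.

Lemma smooth_on_ln {U f} : open U -> smooth_on U f -> (forall x, U x -> 0 < f x) ->
  smooth_on U (fun x => ln (f x) : R).
Proof.
move=> Uo fs f0.
have f0' x : U x -> f x != 0 by move=> /f0; rewrite lt0r => /andP[].
have fVs := smooth_onV Uo fs f0'.
(* The derivative of [ln f] is [1 / f] times a partial of [f]; the inverse is already known to be
   smooth and is adjoined with all its partials. *)
pose S : set ('rV[R]_n -> R) := all_partials f `|` all_partials (fun x => (f x)^-1)
   `|` [set fun x => ln (f x)].
apply: (@alg_smooth_on U S) => //.
- move=> g [[/(all_partials_continuous fs)|/(all_partials_continuous fVs)] gc|->] a.
  + exact: gc.
  + exact: gc.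
  move=> Ua; apply: (@continuous_comp _ _ _ f (@ln R)).
    exact: (smooth_on_continuous fs).
  exact/continuous_ln/f0.
- move=> g i [[/(all_partials_closed i fs)|/(all_partials_closed i fVs)]|->].
  + by move=> [g' ? ?]; exists g' => //; apply: alg_of; do 2 left.
  + by move=> [g' ? ?]; exists g' => //; apply: alg_of; left; right.
  exists (fun x => (f x)^-1 * partial i f x).
    apply: alg_mul; apply: alg_of; left; [right; by exists [::]|].
    by left; exists [:: i].
  move=> a Ua.
  apply: (diff_quotient_comp1 (@ln R) f); first exact/is_derive1_ln/f0.
  by apply: (pderivableP hausdorff_real); have [_] := fs [::] a Ua; exact.
- by apply: alg_of; right.
Qed.

End Algebra.

Section Composition.
Context {R : realType} {m n : nat}.

Lemma continuous_rV {p} {T : topologicalType} (phi : T -> 'rV[R]_p) a :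
  (forall j, {for a, continuous (fun z => phi z 0 j : R)}) ->
  {for a, continuous phi}.
Proof.
move=> phic; rewrite /prop_for /continuous_at.
have : \sum_j phi z 0 j *: delta_mx 0 j @[z --> a] -->
    (\sum_j phi a 0 j *: delta_mx 0 j : 'rV[R]_p).
  by apply: cvg_sum => l _; apply: cvgZr_tmp; exact: phic.
rewrite -row_sum_delta; apply: cvg_trans; apply: near_eq_cvg; near=> z.
exact/esym/row_sum_delta.
Unshelve. all: by end_near. Qed.

Lemma smooth_on_comp (U : set 'rV[R]_n) (V : set 'rV[R]_m) (f : 'rV[R]_m -> R)
    (phi : 'rV[R]_n -> 'rV[R]_m) :
  open U -> open V -> smooth_on V f ->
  (forall j, smooth_on U (fun z => phi z 0 j : R)) ->
  (forall z, U z -> V (phi z)) -> smooth_on U (f \o phi : 'rV[R]_n -> R).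
Proof.
move=> Uo Vo fs phis UV.
(* By the chain rule, the derivative of a partial of [f] composed with [phi] is a sum of products of
   elements of these two families. *)
pose S : set ('rV[R]_n -> R) := [set g \o phi | g in all_partials f] `|`
  \bigcup_j all_partials (fun z => phi z 0 j : R).
apply: (@alg_smooth_on _ _ U S) => //.
- move=> k [[g fg <-]|[j _ jg]] a Ua; last first.
    exact: all_partials_continuous (phis j) jg _ Ua.
  apply: continuous_comp; last exact: all_partials_continuous fs fg _ (UV _ Ua).
  by apply: continuous_rV => j; exact: (smooth_on_continuous (phis j)).
- move=> k i [[_ [s _ <-] <-]|[j _ jg]]; last first.
    have [g' ? ?] := all_partials_closed i (phis j) jg; exists g' => //.
    by apply: alg_of; right; exists j.
  exists (fun z => \sum_j partial i (fun z => phi z 0 j : R) z *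
      (partials (j :: s) f \o phi) z).
    apply: alg_sum => j; apply: alg_mul; apply: alg_of.
      by right; exists j => //; exists [:: i].
    by left; exists (partials (j :: s) f) => //; exists (j :: s).
  move=> a Ua; apply: (chain_rule_smooth _ _ V) => //;
    last by move=> j; have [] := phis j [::] a Ua.
    exact: smooth_on_partials.
  exact: UV.
- by apply: alg_of; left; exists f => //; exists [::].
Qed.

(** A coordinate is linear and continuous, hence commutes with limits of difference quotients. This
    passes from vector-valued chart expressions to the calculus of real functions. *)
Lemma smooth_on_component (phi : 'rV[R]_n -> 'rV[R]_m) (U : set 'rV[R]_n) (j : 'I_m) :
  open U -> smooth_on U phi -> smooth_on U (fun z => phi z 0 j : R).
Proof.
move=> Uo phis.
apply: (@smooth_on_coind _ _ _ hausdorff_real U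
    [set fun z => g z 0 j | g in [set partials s phi | s in setT]]) => //.
- move=> _ [_ [s _ <-] <-] a Ua.
  have [sc _] := phis s a Ua.
  exact: (cvg_comp _ _ sc (@coord_continuous R 1 m 0 j _)).
- move=> _ i [_ [s _ <-] <-].
  exists (fun z => partials (i :: s) phi z 0 j).
    by exists (partials (i :: s) phi) => //; exists (i :: s).
  move=> a Ua; have [_ /(_ i)/pderivableP H] := phis s a Ua.
  have {}H := H (@norm_hausdorff _ ('rV[R]_m : normedModType R)).
  have := cvg_comp _ _ H (@coord_continuous R 1 m 0 j _).
  apply: cvg_trans; apply: near_eq_cvg; near=> h.
  by rewrite /= /diff_quotient !mxE.
- by exists phi => //; exists [::].
Unshelve. all: by end_near. Qed.

End Composition.

(** * Charts and smooth functions on a manifold *)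

Section Charts.
Context {R : realType} {n : nat} {T : topologicalType}.
Implicit Types (c : chart R n T).

Lemma chart_imgP c y : chart_img c y ->
  chart_dom c (chart_inv c y) /\ chart_map c (chart_inv c y) = y.
Proof. by move=> [x xc <-]; rewrite chart_mapK. Qed.

Lemma chart_map_img c x : chart_dom c x -> chart_img c (chart_map c x).
Proof. by move=> xc; exists x. Qed.

Lemma image_chartE c (W : set T) : chart_map c @` (chart_dom c `&` W) =
  [set y | chart_img c y /\ W (chart_inv c y)].
Proof.
apply/seteqP; split=> [_ [x [xc Wx] <-]|y [/chart_imgP[cy yK] Wy]] /=.
  by rewrite chart_mapK//; split=> //; exact: chart_map_img.
by exists (chart_inv c y).
Qed.

Lemma open_preimage_at (X Y : topologicalType) (U : set X) (f : X -> Y) (W : set Y) :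
  open U -> (forall x, U x -> {for x, continuous f}) -> open W ->
  open [set x | U x /\ W (f x)].
Proof.
move=> Uo fc Wo; rewrite openE => x [Ux Wx]; apply: filterI.
  exact: open_nbhs_nbhs.
exact: (fc x Ux) (open_nbhs_nbhs (conj Wo Wx)).
Qed.

Lemma open_chart c (W : set T) : open W ->
  open [set y | chart_img c y /\ W (chart_inv c y)].
Proof.
move=> Wo; apply: open_preimage_at => //; first exact: chart_img_open.
exact: chart_inv_continuous.
Qed.

End Charts.

Section SmoothFunctions.
Context {R : realType} {n : nat} {T : topologicalType} (A : manifold R n T).
Implicit Types (f : T -> R) (W : set T).

Lemma smooth_fun_onP W f : smooth_fun_on A W f <-> forall i,
  smooth_on [set y | chart_img (atlas A i) y /\ W (chart_inv (atlas A i) y)]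
    (f \o chart_inv (atlas A i) : 'rV[R]_n -> R).
Proof. by split=> fs i; have := fs i; rewrite /= image_chartE. Qed.

Lemma sub_smooth_fun_on W W' f : W `<=` W' ->
  smooth_fun_on A W' f -> smooth_fun_on A W f.
Proof.
move=> WW' /smooth_fun_onP fs; apply/smooth_fun_onP => i.
by apply: smooth_on_sub (fs i) => y [? /WW'].
Qed.

Lemma eq_smooth_fun_on W f f' : open W -> (forall x, W x -> f x = f' x) ->
  smooth_fun_on A W f -> smooth_fun_on A W f'.
Proof.
move=> Wo ff' /smooth_fun_onP fs; apply/smooth_fun_onP => i.
apply: eq_smooth_on (fs i); first exact: open_chart.
by move=> y [_ /ff'].
Qed.

Lemma smooth_fun_onM W f f' : open W -> smooth_fun_on A W f ->
  smooth_fun_on A W f' -> smooth_fun_on A W (fun x => f x * f' x).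
Proof.
move=> Wo /smooth_fun_onP fs /smooth_fun_onP fs'; apply/smooth_fun_onP => i.
by apply: smooth_onM (fs i) (fs' i); exact: open_chart.
Qed.

Lemma smooth_fun_onV W f : open W -> smooth_fun_on A W f ->
  (forall x, W x -> f x != 0) -> smooth_fun_on A W (fun x => (f x)^-1).
Proof.
move=> Wo /smooth_fun_onP fs f0; apply/smooth_fun_onP => i.
by apply: smooth_onV (fs i) _; [exact: open_chart|move=> y [_ /f0]].
Qed.

Lemma smooth_fun_on_ln W f : open W -> smooth_fun_on A W f ->
  (forall x, W x -> 0 < f x) -> smooth_fun_on A W (fun x => ln (f x)).
Proof.
move=> Wo /smooth_fun_onP fs f0; apply/smooth_fun_onP => i.
by apply: smooth_on_ln (fs i) _; [exact: open_chart|move=> y [_ /f0]].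
Qed.

Lemma smooth_fun_on_cst W (k : R) : open W -> smooth_fun_on A W (fun=> k).
Proof.
by move=> Wo; apply/smooth_fun_onP => i; apply: smooth_on_cst; exact: open_chart.
Qed.

(** The source is Euclidean of any dimension [p], which covers both a map of [M] read in a chart
    ([p = n]) and the action read in a product chart ([p = k + n]). *)
Definition smooth_into {p} (U : set 'rV[R]_p) (phi : 'rV[R]_p -> T) : Prop :=
  (forall z, U z -> {for z, continuous phi}) /\
  forall j, smooth_on [set z | U z /\ chart_dom (atlas A j) (phi z)]
    (chart_map (atlas A j) \o phi).

Lemma smooth_into_comp {p} (U : set 'rV[R]_p) W f (phi : 'rV[R]_p -> T) :
  open U -> open W -> smooth_into U phi -> smooth_fun_on A W f ->
  (forall z, U z -> W (phi z)) -> smooth_on U (f \o phi : 'rV[R]_p -> R).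
Proof.
move=> Uo Wo [phic phis] /smooth_fun_onP fs UW.
apply: smooth_on_local => z Uz; have [j jz] := atlas_cover A (phi z).
set c := atlas A j in jz.
have Vo : open [set z | U z /\ chart_dom c (phi z)].
  by apply: open_preimage_at => //; exact: chart_dom_open.
exists [set z | U z /\ chart_dom c (phi z)]; split => //.
apply: (@eq_smooth_on _ _ _ _ ((f \o chart_inv c) \o (chart_map c \o phi))) => //.
  by move=> y [_ yc]; rewrite /= chart_mapK.
apply: (smooth_on_comp _ _ _ _ Vo (open_chart c W Wo) (fs j)).
  by move=> l; exact: smooth_on_component (phis j).
move=> y [Uy yc] /=; rewrite chart_mapK//; split; first exact: chart_map_img.
exact: UW.
Qed.

Lemma smooth_map_into (alpha : T -> T) W i : smooth_map A A alpha ->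
  smooth_into [set y | chart_img (atlas A i) y /\ W (chart_inv (atlas A i) y)]
    (alpha \o chart_inv (atlas A i)).
Proof.
move=> [ac asm]; split=> [y [yi _]|j].
  by apply: continuous_comp; [exact: chart_inv_continuous|exact: ac].
by apply: smooth_on_sub (asm i j) => y [[? _]].
Qed.

Lemma smooth_fun_on_comp (alpha : T -> T) W f : open W -> smooth_map A A alpha ->
  smooth_fun_on A W f -> smooth_fun_on A (alpha @^-1` W) (f \o alpha).
Proof.
move=> Wo asm fs; have aWo : open (alpha @^-1` W).
  by move/continuousP: asm.1; exact.
apply/smooth_fun_onP => i; rewrite -compA.
apply: (smooth_into_comp _ _ _ _ (open_chart _ _ aWo) Wo _ fs); last by move=> z [].
exact: smooth_map_into.
Qed.

Lemma smooth_at_comp (alpha : T -> T) x f : smooth_map A A alpha ->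
  smooth_at A (alpha x) f -> smooth_at A x (f \o alpha).
Proof.
move=> asm [W [Wo Wx fs]]; exists (alpha @^-1` W); split => //.
  by move/continuousP: asm.1; exact.
exact: smooth_fun_on_comp.
Qed.

Lemma near_smooth_at x f f' : (\forall y \near x, f y = f' y) ->
  smooth_at A x f -> smooth_at A x f'.
Proof.
move=> ff'; have : nbhs x [set y | f y = f' y] by [].
rewrite nbhsE => -[V [Vo Vx] Vff'] [W [Wo Wx fs]].
exists (W `&` V); split => //; first exact: openI.
apply: (eq_smooth_fun_on _ f); [exact: openI|by move=> y [_ /Vff']|].
by apply: sub_smooth_fun_on fs => y [].
Qed.

Lemma smooth_at_chart x f i : smooth_at A x f -> chart_dom (atlas A i) x ->
  exists V, [/\ open V, V (chart_map (atlas A i) x), V `<=` chart_img (atlas A i) &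
    smooth_on V (f \o chart_inv (atlas A i) : 'rV[R]_n -> R)].
Proof.
move=> [W [Wo Wx /smooth_fun_onP fs]] xi.
exists [set y | chart_img (atlas A i) y /\ W (chart_inv (atlas A i) y)]; split => //.
- exact: open_chart.
- by split=> /=; [exact: chart_map_img|rewrite chart_mapK].
- by move=> y [].
Qed.

(** Read in another chart, these are the components of a transition map. *)
Lemma smooth_fun_on_coord i (j : 'I_n) :
  smooth_fun_on A (chart_dom (atlas A i)) (fun x => chart_map (atlas A i) x 0 j).
Proof.
move=> l /=; have := @atlas_compatible _ _ _ A l i.
set U := _ @` _; move=> ls.
apply: (@smooth_on_component _ _ _ (chart_map (atlas A i) \o chart_inv (atlas A l))) ls.
by rewrite /U image_chartE; apply: open_chart; exact: chart_dom_open.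
Qed.

End SmoothFunctions.

(** * Tangent vectors and metrics *)

Section Tangent.
Context {R : realType} {n : nat} {T : topologicalType} (A : manifold R n T).
Implicit Types (f : T -> R) (v w : (T -> R) -> R) (x : T).

Lemma tangent_lin x (k : R) v w : tangent A x v -> tangent A x w ->
  tangent A x (fun f => k * v f + w f).
Proof.
move=> [vl vM vg v0] [wl wM wg w0]; split.
- by move=> c f f' fs fs'; rewrite vl// wl//; ring.
- by move=> f f' fs fs'; rewrite vM// wM//; ring.
- by move=> f f' ff'; rewrite (vg _ _ ff') (wg _ _ ff').
- by move=> f nf; rewrite v0// w0// mulr0 addr0.
Qed.

Lemma tangent0 x : tangent A x (fun=> 0).
Proof. by split=> *; rewrite ?mulr0 ?mul0r ?addr0. Qed.

Lemma tangent_sum x m (a : 'I_m -> R) (v : 'I_m -> (T -> R) -> R) :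
  (forall j, tangent A x (v j)) ->
  tangent A x (fun f => \sum_j a j * v j f).
Proof.
elim: m a v => [|m IH] a v vt.
  rewrite (_ : (fun _ => _) = fun=> 0); first exact: tangent0.
  by apply/funext => f; rewrite big_ord0.
rewrite (_ : (fun _ => _) = fun f => a ord0 * v ord0 f +
    \sum_j a (lift ord0 j) * v (lift ord0 j) f).
  by apply: tangent_lin => //; exact: IH.
by apply/funext => f; rewrite big_ord_recl.
Qed.

Lemma tangent_pushforward (alpha : T -> T) x v : diffeomorphism A alpha ->
  tangent A x v -> tangent A (alpha x) (Defs.pushforward alpha v).
Proof.
move=> [h [ah ha asm hsm]] [vl vM vg v0].
have cs f : smooth_at A (alpha x) f -> smooth_at A x (f \o alpha).
  exact: smooth_at_comp.
split=> [k f f' fs fs'|f f' fs fs'|f f' ff'|f nf]; rewrite /Defs.pushforward.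
- exact: vl (cs _ fs) (cs _ fs').
- exact: vM (cs _ fs) (cs _ fs').
- by apply: vg; exact: (asm.1 x) ff'.
(* Vanishing on non-smooth functions uses the inverse [h]: if [f \o alpha] is smooth at [x], then
   [f], being [(f \o alpha) \o h], is smooth at [alpha x]. *)
apply: v0 => fs; apply: nf.
have -> : f = (f \o alpha) \o h by apply/funext => y; rewrite /= ha.
by apply: smooth_at_comp => //; rewrite ah.
Qed.

Lemma coord_vectorE (i : atlas_index A) a x f : chart_dom (atlas A i) x ->
  smooth_at A x f ->
  diff_quotient (f \o chart_inv (atlas A i) : 'rV[R]_n -> R) a
    (chart_map (atlas A i) x) h @[h --> 0^'] --> coord_vector i a x f.
Proof.
move=> xi fs; rewrite /coord_vector (asboolT fs).
apply: (pderivableP hausdorff_real).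
by have [V [_ Vx _ /(_ [::] _ Vx)[_ ]]] := smooth_at_chart A x f i fs xi.
Qed.

Lemma coord_vector_tangent (i : atlas_index A) a x : chart_dom (atlas A i) x ->
  tangent A x (coord_vector i a x).
Proof.
move=> xi; split=> [k f f' fs fs'|f f' fs fs'|f f' ff'|f nf].
- have fs2 : smooth_at A x (fun y => k * f y + f' y).
    have [W [Wo Wx fW]] := fs; have [W' [Wo' Wx' fW']] := fs'.
    exists (W `&` W'); split => //; first exact: openI.
    move=> j /=; apply: smooth_on_lin.
    + by rewrite image_chartE; apply: open_chart; exact: openI.
    + by apply: (@sub_smooth_fun_on _ _ _ A _ W) => // y [].
    + by apply: (@sub_smooth_fun_on _ _ _ A _ W') => // y [].
  apply: (@cvg_unique R hausdorff_real) (coord_vectorE i a x _ xi fs2) _.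
  exact: (diff_quotientP (coord_vectorE i a x _ xi fs) (coord_vectorE i a x _ xi fs')).
- have fs2 : smooth_at A x (fun y => f y * f' y).
    have [W [Wo Wx fW]] := fs; have [W' [Wo' Wx' fW']] := fs'.
    exists (W `&` W'); split => //; first exact: openI.
    apply: smooth_fun_onM; first exact: openI.
    + by apply: (@sub_smooth_fun_on _ _ _ A _ W) => // y [].
    + by apply: (@sub_smooth_fun_on _ _ _ A _ W') => // y [].
  apply: (@cvg_unique R hausdorff_real) (coord_vectorE i a x _ xi fs2) _.
  have := diff_quotientM _ _ _ _ _ _ (coord_vectorE i a x _ xi fs)
    (coord_vectorE i a x _ xi fs').
  by rewrite /= chart_mapK.
- have E : smooth_at A x f <-> smooth_at A x f'.
    split; apply: near_smooth_at => //.
    by apply: filterS ff' => y ->.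
  rewrite /coord_vector; case: asboolP => [/E fs|nf]; last first.
    by rewrite asboolF// => /E.
  rewrite asboolT//; apply: near_partial.
  have := @chart_inv_continuous _ _ _ (atlas A i) _ (chart_map_img _ _ xi).
  rewrite /prop_for /continuous_at chart_mapK// => /(_ _ ff').
  exact.
- by rewrite /coord_vector asboolF.
Qed.

(** On the [a]-th coordinate function of the same chart the vector takes the value 1. *)
Lemma coord_vector_neq0 (i : atlas_index A) a x : chart_dom (atlas A i) x ->
  coord_vector i a x <> (fun=> 0).
Proof.
move=> xi /(congr1 (fun v => v (fun y => chart_map (atlas A i) y 0 a))).
have fs : smooth_at A x (fun y => chart_map (atlas A i) y 0 a).
  exists (chart_dom (atlas A i)); split => //; first exact: chart_dom_open.
  exact: smooth_fun_on_coord.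
rewrite /coord_vector asboolT//.
rewrite (near_partial _ (fun y => y 0 a)); last first.
  have := open_nbhs_nbhs
    (conj (@chart_img_open _ _ _ (atlas A i)) (chart_map_img _ _ xi)).
  by apply: filterS => y /chart_imgP[_ /= ->].
rewrite (cvg_partial hausdorff_real _ _ _ _ (diff_quotient_coord a a _)) eqxx.
by move/eqP; rewrite oner_eq0.
Qed.

Lemma pushforward_coord_vector (alpha : T -> T) (i j : atlas_index A) a x :
  diffeomorphism A alpha -> chart_dom (atlas A i) x ->
  chart_dom (atlas A j) (alpha x) ->
  Defs.pushforward alpha (coord_vector i a x) = fun f => \sum_l
    partial a (fun y => (chart_map (atlas A j) (alpha (chart_inv (atlas A i) y)))
      0 l : R) (chart_map (atlas A i) x) * coord_vector j l (alpha x) f.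
Proof.
move=> da xi xj; have [h [ah ha asm hsm]] := da; apply/funext => f.
set c := atlas A i in xi *; set d := atlas A j in xj *.
(* For [f] not smooth at [alpha x] both sides are 0 by the convention in [tangent]; otherwise the
   formula is the chain rule. *)
have [fs|nfs] := pselect (smooth_at A (alpha x) f); last first.
  have [_ _ _ ->//] := tangent_pushforward _ _ _ da (coord_vector_tangent i a x xi).
  by rewrite big1// => l _; rewrite /coord_vector asboolF// mulr0.
have fas : smooth_at A x (f \o alpha) by exact: smooth_at_comp.
rewrite /Defs.pushforward /coord_vector asboolT// asboolT//.
have [V [Vo Vx _ fV]] := smooth_at_chart A _ f j fs xj.
have [_ /(_ i j)/= as2] := asm; rewrite -/c -/d in as2.
set phi := chart_map d \o alpha \o chart_inv c in as2.
set U := [set y | _ /\ _] in as2.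
have Ux : U (chart_map c x).
  by split; [exact: chart_map_img|rewrite chart_mapK].
have Uo : open U.
  apply: (open_chart c (alpha @^-1` chart_dom d)).
  by move/continuousP: asm.1; apply; exact: chart_dom_open.
have phix : phi (chart_map c x) = chart_map d (alpha x) by rewrite /phi /= chart_mapK.
rewrite (near_partial _ ((f \o chart_inv d) \o phi)); last first.
  apply: filterS (open_nbhs_nbhs (conj Uo Ux)) => y [_ yd].
  by rewrite /phi /= chart_mapK.
rewrite -phix; apply: (cvg_partial hausdorff_real).
apply: (chain_rule_smooth _ _ V) => //; first by rewrite phix.
move=> l; have := @smooth_on_component _ _ _ phi U l Uo as2.
by move=> /(_ [::] _ Ux)[_ ]; exact.
Qed.

End Tangent.

Section Metric.
Context {R : realType} {n : nat} {T : topologicalType} {A : manifold R n T}.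
Variable g : riemannian_metric A.

Lemma metric_suml x m (a : 'I_m -> R) (v : 'I_m -> (T -> R) -> R) w :
  (forall j, tangent A x (v j)) -> tangent A x w ->
  g x (fun f => \sum_j a j * v j f) w = \sum_j a j * g x (v j) w.
Proof.
move=> + wt; elim: m a v => [|m IH] a v vt.
  (* The empty sum is written as [- w + w] because [metric_linear] speaks of combinations of two
     vectors. *)
  rewrite big_ord0 (_ : (fun _ => _) = fun f => - 1 * w f + w f); last first.
    by apply/funext => f; rewrite big_ord0; ring.
  by rewrite metric_linear// mulN1r addNr.
rewrite (_ : (fun _ => _) = fun f => a ord0 * v ord0 f +
    \sum_j a (lift ord0 j) * v (lift ord0 j) f); last first.
  by apply/funext => f; rewrite big_ord_recl.
rewrite metric_linear// ?IH ?big_ord_recl//; exact: tangent_sum.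
Qed.

Lemma metric_quadratic x m (a : 'I_m -> R) (v : 'I_m -> (T -> R) -> R) :
  (forall j, tangent A x (v j)) ->
  g x (fun f => \sum_j a j * v j f) (fun f => \sum_j a j * v j f) =
  \sum_j \sum_l g x (v j) (v l) * a j * a l.
Proof.
move=> vt; rewrite metric_suml//; last exact: tangent_sum.
apply: eq_bigr => j _; rewrite Defs.metric_sym//; last exact: tangent_sum.
rewrite metric_suml// mulr_sumr; apply: eq_bigr => l _.
by rewrite Defs.metric_sym//; ring.
Qed.

Lemma metric_coord_gt0 i a x : chart_dom (atlas A i) x ->
  0 < g x (coord_vector i a x) (coord_vector i a x).
Proof.
move=> xi; apply: metric_pos; first exact: coord_vector_tangent.
exact: coord_vector_neq0.
Qed.

Lemma metric_scale (v : T -> R) : pos_smooth A v ->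
  exists h : riemannian_metric A, forall x w w', h x w w' = v x * g x w w'.
Proof.
move=> [vs v0]; unshelve eexists.
  apply: (@RiemannianMetric _ _ _ A (fun x w w' => v x * g x w w')).
  - by move=> x k w w' u wt wt' ut; rewrite metric_linear//; ring.
  - by move=> x w w' wt wt'; rewrite Defs.metric_sym.
  - by move=> x w wt w0; rewrite mulr_gt0//; exact: metric_pos.
  - move=> i a b; apply: smooth_fun_onM; first exact: chart_dom_open.
      by apply: sub_smooth_fun_on vs.
    exact: metric_smooth.
by [].
Qed.

Lemma conformal_factor_coord (alpha : T -> T) (u : T -> R) i j a x :
  diffeomorphism A alpha -> pullback_scales g alpha u ->
  chart_dom (atlas A i) x -> chart_dom (atlas A j) (alpha x) ->
  let d l := partial a (fun y =>
    (chart_map (atlas A j) (alpha (chart_inv (atlas A i) y))) 0 l : R)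
    (chart_map (atlas A i) x) in
  u x = (\sum_l \sum_m g (alpha x) (coord_vector j l (alpha x))
      (coord_vector j m (alpha x)) * d l * d m) /
    g x (coord_vector i a x) (coord_vector i a x).
Proof.
move=> da ua xi xj d; have xt := coord_vector_tangent A i a x xi.
have g0 := metric_coord_gt0 i a x xi.
apply/(canRL (mulfK _)); first by rewrite gt_eqF.
rewrite -ua// (pushforward_coord_vector A alpha i j)// metric_quadratic//.
by move=> l; exact: coord_vector_tangent.
Qed.

Hypothesis n0 : (0 < n)%N.

(** A single coordinate vector decides, since its square under [g] is positive; it exists because
    [0 < n]. *)
Lemma pullback_scales_unique (alpha : T -> T) (u u' : T -> R) :
  pullback_scales g alpha u -> pullback_scales g alpha u' -> u = u'.
Proof.
move=> ua ua'; apply/funext => x; have [i xi] := atlas_cover A x.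
have xt := coord_vector_tangent A i (Ordinal n0) x xi.
have := ua x _ _ xt xt; rewrite (ua' x)// => /mulIf H; apply/esym/H.
by rewrite gt_eqF// metric_coord_gt0.
Qed.

Lemma conformal_factorP (alpha : T -> T) : conformal_automorphism g alpha ->
  pos_smooth A (conformal_factor g alpha) /\
  pullback_scales g alpha (conformal_factor g alpha).
Proof.
move=> [_ uP].
exact: (@xgetPex _ (fun=> 1)
  [set u | pos_smooth A u /\ pullback_scales g alpha u] uP).
Qed.

Lemma conformal_factorE (alpha : T -> T) (u : T -> R) :
  conformal_automorphism g alpha -> pullback_scales g alpha u ->
  conformal_factor g alpha = u.
Proof.
by move=> /conformal_factorP[_ H] ua; exact: (pullback_scales_unique _ _ _ H ua).
Qed.

End Metric.

(** * The topology of C^infinity(M) *)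

Section CinftyTopology.
Context {R : realType} {n : nat} {T : topologicalType} (A : manifold R n T).

(** Unfolds an initial topology for a product of topologies of compact convergence: one chart, one
    word of derivatives and one compact set at a time. *)
Lemma cvg_Cinfty {X : Type} (F : set_system X) {FF : Filter F}
    (L : X -> Cinfty A) (l : Cinfty A) :
  (forall j s (K : set 'rV[R]_n), compact K -> K `<=` chart_img (atlas A j) ->
    forall e : R, 0 < e -> \forall t \near F, forall y, K y ->
    `|partials s (l \o chart_inv (atlas A j)) y -
      partials s (L t \o chart_inv (atlas A j)) y| < e) ->
  L t @[t --> F] --> l.
Proof.
move=> H.
have Hjet : (@Cinfty_jet R n T A \o L) t @[t --> F] --> Cinfty_jet l.
  apply/cvg_sup => -[j s] W [V [[V' V'o <-] /= V'l] /filterS]; apply.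
  suff : (Cinfty_jet (L t) (j, s)) @[t --> F] --> Cinfty_jet l (j, s).
    by apply; exact: open_nbhs_nbhs.
  apply/fam_cvgP => K [Kc Kj] P /uniform_nbhs[E [Eent EP]].
  move: Eent; rewrite -entourage_ballE => -[e e0 eE].
  rewrite nbhs_simpl /=; near=> t; apply: EP => y Ky; apply: eE => /=.
  rewrite -ball_normE /=; move: y Ky; near: t; exact: H.
move=> U [? [[W Wo <-] /= Wl] /filterS]; apply.
exact: Hjet (open_nbhs_nbhs (conj Wo Wl)).
Unshelve. all: by end_near. Qed.

(** The value at [x] is the jet component for the empty word in a chart around [x], and a singleton
    is compact. Evaluations separate functions, whence the Hausdorff property that makes partial
    derivatives in C^infinity(M) unique. *)
Lemma Cinfty_eval_continuous (x : T) : continuous (fun f : Cinfty A => f x).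
Proof.
move=> f; have [j xj] := atlas_cover A x; set y := chart_map (atlas A j) x.
have jetf : @Cinfty_jet R n T A g @[g --> f] --> Cinfty_jet f.
  exact: initial_continuous.
have {}jetf := cvg_comp _ _ jetf (@proj_continuous
  {classic (atlas_index A * seq 'I_n)} (fun p =>
  {family [set K | compact K /\ K `<=` chart_img (atlas A p.1)], 'rV[R]_n -> R})
  (j, [::]) (Cinfty_jet f)).
have Ky : [set K | compact K /\ K `<=` chart_img (atlas A j)] [set y].
  by split=> [|_ ->]; [exact: compact_set1|exact: chart_map_img].
have FF : Filter (Cinfty_jet g (j, [::]) @[g --> f]).
  by apply: fmap_filter; exact: (@nbhs_filter (Cinfty A) f).
have := (fam_cvgP _ _ FF).1 jetf _ Ky.
have jetE (h : Cinfty A) : Cinfty_jet h (j, [::]) y = h x.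
  by rewrite /Cinfty_jet /= chart_mapK.
have -> : (fun h : Cinfty A => h x) = fun h => Cinfty_jet h (j, [::]) y.
  by apply/funext => h; rewrite jetE.
by rewrite uniform_set1.
Qed.

Lemma Cinfty_hausdorff : hausdorff_space (Cinfty A).
Proof.
move=> f g fg; apply/val_inj/funext => x /=.
apply: (@norm_hausdorff _ R^o) => B C Bf Cg.
have [h [/= Bh Ch]] := fg _ _ (Cinfty_eval_continuous x f _ Bf)
  (Cinfty_eval_continuous x g _ Cg).
by exists (h x).
Qed.

End CinftyTopology.

(** * Jointly smooth functions as smooth maps to C^infinity(M) *)

Section Slices.
Context {R : realType} {k n : nat}.
Implicit Types (F : 'rV[R]_(k + n) -> R) (b : 'rV[R]_k) (y : 'rV[R]_n).

Lemma row_mx_shiftl b y i (h : R) :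
  row_mx (h *: delta_mx 0 i + b) y = h *: delta_mx 0 (lshift n i) + row_mx b y.
Proof.
by rewrite -{1}[y]add0r -add_row_mx -[X in row_mx _ X](scaler0 _ h) -scale_row_mx
  delta_mx_lshift.
Qed.

Lemma row_mx_shiftr b y i (h : R) :
  row_mx b (h *: delta_mx 0 i + y) = h *: delta_mx 0 (rshift k i) + row_mx b y.
Proof.
by rewrite -{1}[b]add0r -add_row_mx -[X in row_mx X](scaler0 _ h) -scale_row_mx
  delta_mx_rshift.
Qed.

Lemma diff_quotient_slicer F b i y :
  diff_quotient (fun y => F (row_mx b y)) i y =
  diff_quotient F (rshift k i) (row_mx b y).
Proof. by apply/funext => h; rewrite /diff_quotient row_mx_shiftr. Qed.

Lemma diff_quotient_slicel F b i y :
  diff_quotient (fun b => F (row_mx b y)) i b =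
  diff_quotient F (lshift n i) (row_mx b y).
Proof. by apply/funext => h; rewrite /diff_quotient row_mx_shiftl. Qed.

Lemma partial_slicer F b i y :
  partial i (fun y => F (row_mx b y)) y = partial (rshift k i) F (row_mx b y).
Proof. by rewrite /partial diff_quotient_slicer. Qed.

Lemma partial_slicel F b i y :
  partial i (fun b => F (row_mx b y)) b = partial (lshift n i) F (row_mx b y).
Proof. by rewrite /partial diff_quotient_slicel. Qed.

Lemma partials_slicer F b s :
  partials s (fun y => F (row_mx b y)) =
  fun y => partials (map (@rshift k n) s) F (row_mx b y).
Proof.
elim: s => [//|i s /= ->]; apply/funext => y; exact: partial_slicer.
Qed.

Lemma row_mx_continuous : continuous (fun p : 'rV[R]_n * 'rV[R]_k => row_mx p.2 p.1).
Proof.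
move=> [y b]; apply: continuous_rV => j; rewrite /prop_for /continuous_at /=.
case: (splitP j) => l jl.
  have -> : j = lshift n l by exact/val_inj.
  rewrite row_mxEl; under eq_fun do rewrite row_mxEl.
  exact: (cvg_comp snd _ (@cvg_snd _ _ (nbhs y) (nbhs b) _)
    (@coord_continuous R 1 k 0 l b)).
have -> : j = rshift k l by exact/val_inj.
rewrite row_mxEr; under eq_fun do rewrite row_mxEr.
exact: (cvg_comp fst _ (@cvg_fst _ _ (nbhs y) (nbhs b) _)
  (@coord_continuous R 1 n 0 l y)).
Qed.

Lemma row_mxr_continuous b : continuous (fun y : 'rV[R]_n => row_mx b y).
Proof.
move=> y; have yb : (y', b) @[y' --> y] --> (y, b).
  exact: (@cvg_pair _ _ _ (nbhs y) (nbhs y) (nbhs b) _ _ _ id (fun=> b)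
    cvg_id (cvg_cst b)).
exact: (cvg_comp _ _ yb (row_mx_continuous (y, b))).
Qed.

Lemma lsubmx_continuous : continuous (@lsubmx R 1 k n).
Proof.
move=> z; apply: continuous_rV => j; rewrite /prop_for /continuous_at.
by under eq_fun do rewrite mxE; rewrite mxE; exact: coord_continuous.
Qed.

Lemma rsubmx_continuous : continuous (@rsubmx R 1 k n).
Proof.
move=> z; apply: continuous_rV => j; rewrite /prop_for /continuous_at.
by under eq_fun do rewrite mxE; rewrite mxE; exact: coord_continuous.
Qed.

Lemma open_prod (U : set 'rV[R]_k) (V : set 'rV[R]_n) : open U -> open V ->
  open [set z : 'rV[R]_(k + n) | U (lsubmx z) /\ V (rsubmx z)].
Proof.
move=> Uo Vo; apply: openI.
  by move/continuousP: lsubmx_continuous; exact.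
by move/continuousP: rsubmx_continuous; exact.
Qed.

End Slices.

Section IteratedPartials.
Context {R : realType} {n : nat}.
Implicit Types (f g : 'rV[R]_n -> R) (U : set 'rV[R]_n).

Lemma partials_lin U (c : R) f g s a : open U -> smooth_on U f -> smooth_on U g ->
  U a -> partials s (fun y => c * f y + g y : R) a =
         c * partials s f a + partials s g a.
Proof.
move=> Uo fs gs; elim: s a => [//|i s IH] a Ua /=.
rewrite (near_partial _ (fun y => c * partials s f y + partials s g y)); last first.
  by apply: filterS (open_nbhs_nbhs (conj Uo Ua)) => y /IH.
have [_ /(_ i)/(pderivableP hausdorff_real) fd] := fs s a Ua.
have [_ /(_ i)/(pderivableP hausdorff_real) gd] := gs s a Ua.
exact/(cvg_partial hausdorff_real)/(diff_quotientP fd gd).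
Qed.

(** Iterated symmetry of second partials; it serves to move the derivative in the parameter past all
    derivatives in x. *)
Lemma partials_partial_comm U f s i a : open U -> smooth_on U f -> U a ->
  partials s (partial i f) a = partial i (partials s f) a.
Proof.
move=> Uo fs; elim: s a => [//|j s IH] a Ua /=.
rewrite (near_partial _ (partial i (partials s f))).
  exact: (partial_comm U _ _ _ _ Uo (smooth_on_partials s fs)).
by apply: filterS (open_nbhs_nbhs (conj Uo Ua)) => y /IH.
Qed.

End IteratedPartials.

(** The tube lemma, which turns local joint estimates into uniform ones over a compact set. *)
Lemma near_compact {X : topologicalType} {I : Type} {F : set_system I}
    {FF : Filter F} (K : set X) (P : I -> X -> Prop) : compact K ->
  (forall x, K x -> \forall x' \near x & i \near F, P i x') ->
  \forall i \near F, K `<=` P i.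
Proof. by move=> /compact_near_coveringP; apply. Qed.

Section ExponentialLaw.
Context {R : realType} {k n : nat} {T : topologicalType} (A : manifold R n T).
Variable U : set 'rV[R]_k.
Hypothesis Uo : open U.
Implicit Types (H : 'rV[R]_k -> T -> R).

Let dom j := [set z : 'rV[R]_(k + n) |
  U (lsubmx z) /\ chart_img (atlas A j) (rsubmx z)].
Let loc H j := fun z : 'rV[R]_(k + n) =>
  H (lsubmx z) (chart_inv (atlas A j) (rsubmx z)).

Definition jointly_smooth H : Prop := forall j, smooth_on (dom j) (loc H j).

Let dom_open j : open (dom j).
Proof. by apply: open_prod => //; exact: chart_img_open. Qed.

Let dom_row j b y : U b -> chart_img (atlas A j) y -> dom j (row_mx b y).
Proof. by rewrite /dom /= row_mxKl row_mxKr. Qed.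

Let loc_row H j b : H b \o chart_inv (atlas A j) = fun y => loc H j (row_mx b y).
Proof. by apply/funext => y; rewrite /loc row_mxKl row_mxKr. Qed.

Lemma jointly_smooth_fun H b : jointly_smooth H -> U b -> smooth_fun A (H b).
Proof.
move=> Hs Ub; apply/smooth_fun_onP => j s y [yj _].
rewrite loc_row partials_slicer.
have [sc sd] := Hs j (map (@rshift k n) s) _ (dom_row j b y Ub yj); split.
  exact: (cvg_comp _ _ (row_mxr_continuous b y) sc).
by move=> i; have := sd (rshift k i); rewrite /pderivable -diff_quotient_slicer.
Qed.

Definition partial_param i H : 'rV[R]_k -> T -> R :=
  fun b x => partial i (fun b => H b x : R) b.

Let loc_partial i H j : loc (partial_param i H) j = partial (lshift n i) (loc H j).
Proof.
apply/funext => z; rewrite /loc /partial_param -{3}[z]hsubmxK -partial_slicel.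
by congr (partial _ _ _); apply/funext => b; rewrite row_mxKl row_mxKr.
Qed.

Lemma jointly_smooth_partial i H :
  jointly_smooth H -> jointly_smooth (partial_param i H).
Proof. by move=> Hs j; rewrite loc_partial; exact: smooth_on_partial. Qed.

Lemma jointly_smooth_continuous H (L : 'rV[R]_k -> Cinfty A) : jointly_smooth H ->
  (forall b, U b -> L b = H b :> (T -> R)) ->
  forall a, U a -> {for a, continuous L}.
Proof.
move=> Hs LH a Ua.
apply: (@cvg_Cinfty R n T A _ (nbhs a) (nbhs_filter a)) => j s K Kc Kj e e0.
set r := map (@rshift k n) s.
have P : \forall b \near a, K `<=` fun y =>
    `|partials r (loc H j) (row_mx a y) - partials r (loc H j) (row_mx b y)| < e.
  apply: (@near_compact _ _ (nbhs a) (nbhs_filter a) K _ Kc) => y0 /Kj y0j.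
  have [/cvgrPdist_lt/(_ (e / 2)) c _] := Hs j r _ (dom_row j a y0 Ua y0j).
  have {}c := c (divr_gt0 e0 (ltr0n _ 2)).
  (* The values at [(b, y)] and at [(a, y)] are both compared with the one at [(a, y0)], whence the
     two bounds by [e / 2]. *)
  have c1 : \forall y \near y0 & b \near a, `|partials r (loc H j) (row_mx a y0) -
      partials r (loc H j) (row_mx b y)| < e / 2 := row_mx_continuous (y0, a) _ c.
  have c2 : \forall y \near y0 & b \near a, `|partials r (loc H j) (row_mx a y0) -
      partials r (loc H j) (row_mx a y)| < e / 2.
    exact: cvg_comp _ _ (@cvg_fst _ _ (nbhs y0) (nbhs a) _)
      (row_mxr_continuous a y0) _ c.
  apply: (@filterS2 _ (filter_prod (nbhs y0) (nbhs a)) _ _ _ _ _ c1 c2)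
    => -[y b] /= yb ya.
  rewrite [e]splitr -(subrKA (partials r (loc H j) (row_mx a y0))).
  by rewrite (le_lt_trans (ler_normD _ _))// ltrD// distrC.
apply: (@filterS2 _ (nbhs a) _ _ _ _ _ P (open_nbhs_nbhs (conj Uo Ua)))
  => b Kb Ub y /Kb.
by rewrite !LH// !loc_row !partials_slicer.
Qed.

(** Derivatives in x commute with the difference quotient in the parameter, so a jet component of
    the quotient is a slope of the corresponding derivative [Psi]. The joint limit [slope_cvg] and
    the tube lemma make its convergence uniform on [K], and symmetry of partials identifies the
    limit. *)
Lemma jointly_smooth_derive H (L L' : 'rV[R]_k -> Cinfty A) i : jointly_smooth H ->
  (forall b, U b -> L b = H b :> (T -> R)) ->
  (forall b, U b -> L' b = partial_param i H b :> (T -> R)) ->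
  forall a, U a -> diff_quotient L i a h @[h --> 0^'] --> L' a.
Proof.
move=> Hs LH L'H a Ua.
apply: (@cvg_Cinfty R n T A R (0 : R)^' _) => j s K Kc Kj e e0.
set r := map (@rshift k n) s; set i' := lshift n i.
pose Psi := partials r (loc H j).
have Psis : smooth_on (dom j) Psi by exact: smooth_on_partials.
have P : \forall h \near (0 : R), K `<=` fun y =>
    `|partial i' Psi (row_mx a y) - slope Psi i' (row_mx a y) h| < e.
  apply: (@near_compact _ _ (nbhs (0 : R)) (nbhs_filter _) K _ Kc) => y0 /Kj y0j.
  have z0 := dom_row j a y0 Ua y0j.
  have Pc := smooth_on_continuous (smooth_on_partial i' Psis) _ z0.
  have Pd : \forall z \near row_mx a y0, pderivable Psi i' z.
    by apply: filterS (open_nbhs_nbhs (conj (dom_open j) z0)) => z /(Psis [::])[].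
  have /cvgrPdist_lt/(_ _ (divr_gt0 e0 (ltr0n _ 2))) c1 := slope_cvg _ _ _ Pd Pc.
  have /cvgrPdist_lt/(_ _ (divr_gt0 e0 (ltr0n _ 2))) c2 := Pc.
  have ya : (row_mx a p.1, p.2) @[p --> (y0, 0 : R)] --> (row_mx a y0, 0 : R).
    have fstc : fst @ filter_prod (nbhs y0) (nbhs (0 : R)) --> y0 by exact: cvg_fst.
    have sndc : snd @ filter_prod (nbhs y0) (nbhs (0 : R)) --> (0 : R).
      exact: cvg_snd.
    exact: (cvg_pair (cvg_comp _ _ fstc (row_mxr_continuous a y0)) sndc).
  have {}c1 : \forall y \near y0 & h \near (0 : R),
      `|partial i' Psi (row_mx a y0) - slope Psi i' (row_mx a y) h| < e / 2.
    exact: ya _ c1.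
  have {}c2 : \forall y \near y0 & h \near (0 : R),
      `|partial i' Psi (row_mx a y0) - partial i' Psi (row_mx a y)| < e / 2.
    exact: cvg_comp _ _ (@cvg_fst _ _ (nbhs y0) (nbhs (0 : R)) _)
      (row_mxr_continuous a y0) _ c2.
  apply: (@filterS2 _ (filter_prod (nbhs y0) (nbhs (0 : R))) _ _ _ _ _ c1 c2)
    => -[y h] /= yh y'.
  rewrite [e]splitr -(subrKA (partial i' Psi (row_mx a y0))).
  by rewrite (le_lt_trans (ler_normD _ _))// ltrD// distrC.
have Uh : \forall h \near (0 : R)^', U (h *: delta_mx 0 i + a).
  exact: (cvg_line a (delta_mx 0 i)) (open_nbhs_nbhs (conj Uo Ua)).
have Pn : \forall h \near (0 : R)^', K `<=` fun y =>
    `|partial i' Psi (row_mx a y) - slope Psi i' (row_mx a y) h| < e.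
  exact: cvg_within.
near=> h => y Ky; have yj := Kj _ Ky; have z := dom_row j a y Ua yj.
have h0 : h != 0 by near: h; exact: nbhs_dnbhs_neq.
have Uha : U (h *: delta_mx 0 i + a) by near: h.
have -> : partials s (L' a \o chart_inv (atlas A j)) y = partial i' Psi (row_mx a y).
  rewrite L'H// loc_row partials_slicer loc_partial.
  exact: (partials_partial_comm _ _ _ _ _ (dom_open j)).
suff -> : partials s (diff_quotient L i a h \o chart_inv (atlas A j)) y =
    slope Psi i' (row_mx a y) h.
  by move: y Ky {yj z}; near: h.
set D := diff_quotient L i a h.
have DE x : D x = h^-1 * (L (h *: delta_mx 0 i + a) x - L a x) by [].
(* Written without division to fit the shape [c * f + g] of [partials_lin]; the factor [h] is
   cancelled against that of [slopeE] afterwards. *)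
have HD : H (h *: delta_mx 0 i + a) \o chart_inv (atlas A j) =
    fun y => h * (D \o chart_inv (atlas A j)) y + (H a \o chart_inv (atlas A j)) y.
  apply/funext => y'; rewrite /comp DE -!LH// mulrA divff// mul1r.
  by rewrite subrK.
have sm (f : T -> R) : smooth_fun A f ->
    smooth_on (chart_img (atlas A j)) (f \o chart_inv (atlas A j) : 'rV[R]_n -> R).
  move=> /smooth_fun_onP/(_ j); apply: smooth_on_sub => y' y'j; by split.
have /asboolP Ds := Cinfty_smooth D.
have := partials_lin _ h _ _ s y (@chart_img_open _ _ _ (atlas A j)) (sm _ Ds)
  (sm _ (jointly_smooth_fun H a Hs Ua)) yj.
rewrite -HD !loc_row !partials_slicer -/r -/Psi row_mx_shiftl -/i' => /eqP.
rewrite -subr_eq slopeE => /eqP /(mulfI h0) <-.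
by [].
Unshelve. all: by end_near. Qed.

Lemma smooth_on_Cinfty H (L : 'rV[R]_k -> Cinfty A) : jointly_smooth H ->
  (forall b, U b -> L b = H b :> (T -> R)) -> smooth_on U L.
Proof.
move=> Hs LH; pose C : set ('rV[R]_k -> Cinfty A) := [set L | exists2 H,
  jointly_smooth H & forall b, U b -> L b = H b :> (T -> R)].
apply: (smooth_on_coind (Cinfty_hausdorff A) U C Uo) => [f [G Gs fG]|f i [G Gs fG]|].
- exact: jointly_smooth_continuous fG.
- have Gs' := jointly_smooth_partial i G Gs.
  (* Off [U] the function [partial_param i G b] may fail to be smooth; the default 0 is then
     taken. *)
  pose f' b : Cinfty A := xget 0
    [set l : Cinfty A | l = partial_param i G b :> (T -> R)].
  have f'E b : U b -> f' b = partial_param i G b :> (T -> R).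
    move=> Ub; have /asboolP Gb := jointly_smooth_fun _ _ Gs' Ub.
    by apply: (@xgetPex _ _ [set l : Cinfty A | l = partial_param i G b :> (T -> R)]);
      exists (MkCinfty Gb).
  exists f'; first by exists (partial_param i G).
  exact: jointly_smooth_derive fG f'E.
- by exists H.
Qed.

End ExponentialLaw.

(** * The conformal cocycle *)

Lemma smooth_on_lsubmx {R : realType} {k n : nat} (U : set 'rV[R]_(k + n)) l :
  open U -> smooth_on U (fun z => lsubmx z 0 l : R).
Proof.
move=> Uo; apply: eq_smooth_on (smooth_on_coord U (lshift n l) Uo) => // z _.
by rewrite mxE.
Qed.

Lemma smooth_on_rsubmx {R : realType} {k n : nat} (U : set 'rV[R]_(k + n)) l :
  open U -> smooth_on U (fun z => rsubmx z 0 l : R).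
Proof.
move=> Uo; apply: eq_smooth_on (smooth_on_coord U (rshift k l) Uo) => // z _.
by rewrite mxE.
Qed.

Section ConformalCocycle.
Context {R : realType} {n k : nat} {M : topologicalType} {A : manifold R n M}.
Context {G : lieGroup R k} {act : G -> M -> M} {g : riemannian_metric A}.
Hypothesis n0 : (0 < n)%N.
Hypothesis hG : conformal_lie_subgroup act g.

Let u a := conformal_factor g (act a).

Lemma conformal_act a : conformal_automorphism g (act a).
Proof. by case: hG. Qed.

Lemma conformal_act_diffeomorphism a : diffeomorphism A (act a).
Proof. by case: (conformal_act a). Qed.

Lemma actKV a x : act a (act (a^-1)%g x) = x.
Proof. by case: hG => [act1 actM _ _ _]; rewrite -actM mulgV act1. Qed.

Lemma actVK a x : act (a^-1)%g (act a x) = x.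
Proof. by case: hG => [act1 actM _ _ _]; rewrite -actM mulVg act1. Qed.

Lemma factor_pullback a : pullback_scales g (act a) (u a).
Proof. exact: (conformal_factorP g _ (conformal_act a)).2. Qed.

Lemma factor_smooth a : smooth_fun A (u a).
Proof. exact: (conformal_factorP g _ (conformal_act a)).1.1. Qed.

Lemma factor_gt0 a x : 0 < u a x.
Proof. exact: (conformal_factorP g _ (conformal_act a)).1.2. Qed.

Lemma factorM a b x : u (a * b)%g x = u a (act b x) * u b x.
Proof.
have [act1 actM _ _ _] := hG.
suff -> : u (a * b)%g = fun x => u a (act b x) * u b x by [].
apply: (conformal_factorE g n0) => [|y v w vt wt]; first exact: conformal_act.
have -> : act (a * b)%g = act a \o act b by apply/funext => z; exact: actM.
have db := conformal_act_diffeomorphism b.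
rewrite -mulrA -(factor_pullback b y v w vt wt).
by apply: factor_pullback; exact: tangent_pushforward.
Qed.

Lemma factor1 x : u 1%g x = 1.
Proof.
have /eqP := factorM 1 1 x; have [act1 _ _ _ _] := hG.
rewrite mulg1 act1 -{1}[u _ x]mul1r => /eqP /mulIf -> //.
by rewrite gt_eqF// factor_gt0.
Qed.

(** This form removes the action from the argument of the factor: smoothness of [lambda_Conf] then
    reduces to that of [u] and of inversion in [G]. *)
Lemma lambda_ConfE a x : lambda_Conf act g a x = (u (a^-1)%g x)^-1.
Proof.
have := factorM a (a^-1)%g x; rewrite mulgV factor1 => E.
apply: (mulIf (x := u (a^-1)%g x)); first by rewrite gt_eqF// factor_gt0.
by rewrite mulVf ?gt_eqF ?factor_gt0.
Qed.

Lemma lambda_Conf_gt0 a x : 0 < lambda_Conf act g a x.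
Proof. by rewrite lambda_ConfE invr_gt0 factor_gt0. Qed.

Lemma lambda_Conf_smooth a : smooth_fun A (lambda_Conf act g a).
Proof.
have -> : lambda_Conf act g a = fun x => (u (a^-1)%g x)^-1.
  by apply/funext => x; exact: lambda_ConfE.
apply: (smooth_fun_onV A _ _ openT (factor_smooth _)) => x _.
by rewrite gt_eqF// factor_gt0.
Qed.

Let dom2 (i : atlas_index (lie_manifold G)) (j : atlas_index A) :=
  [set z : 'rV[R]_(k + n) | chart_img (atlas (lie_manifold G) i) (lsubmx z) /\
    chart_img (atlas A j) (rsubmx z)].

Let dom2_open i j : open (dom2 i j).
Proof. by apply: open_prod; exact: chart_img_open. Qed.

Let Phi (i : atlas_index (lie_manifold G)) (j : atlas_index A)
    (z : 'rV[R]_(k + n)) : M :=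
  act (chart_inv (atlas (lie_manifold G) i) (lsubmx z))
    (chart_inv (atlas A j) (rsubmx z)).

Lemma act_smooth_into i j : smooth_into A (dom2 i j) (Phi i j).
Proof.
have [_ _ _ [actc acts] _] := hG; split=> [z [zi zj]|l]; last first.
  by apply: smooth_on_sub (acts i j l) => z [[zi zj] zl].
have c1 : {for z, continuous (chart_inv (atlas (lie_manifold G) i) \o lsubmx)}.
  apply: continuous_comp; first exact: lsubmx_continuous.
  exact: chart_inv_continuous.
have c2 : {for z, continuous (chart_inv (atlas A j) \o rsubmx)}.
  apply: continuous_comp; first exact: rsubmx_continuous.
  exact: chart_inv_continuous.
exact: (cvg_comp _ _ (cvg_pair c1 c2) (actc (_, _))).
Qed.

Lemma smooth_on_comp_rsubmx i j f (W : set M) : open W -> smooth_fun_on A W f ->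
  smooth_on [set z | dom2 i j z /\ W (chart_inv (atlas A j) (rsubmx z))]
    (fun z => f (chart_inv (atlas A j) (rsubmx z)) : R).
Proof.
move=> Wo /smooth_fun_onP/(_ j) fs.
have Do : open [set z | dom2 i j z /\ W (chart_inv (atlas A j) (rsubmx z))].
  apply: (open_preimage_at _ _ _ (chart_inv (atlas A j) \o rsubmx)) => // z [_ zj].
  apply: continuous_comp; first exact: rsubmx_continuous.
  exact: chart_inv_continuous.
apply: (smooth_on_comp _ _ _ _ Do (open_chart _ _ Wo) fs) => [l|z [[_ zj] zW]].
  exact: smooth_on_rsubmx.
by split.
Qed.

(* Near a point the factor is given by [conformal_factor_coord], whose right-hand
   side is visibly smooth in both variables. *)
Lemma factor_jointly_smooth i j : smooth_on (dom2 i j)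
  (fun z => u (chart_inv (atlas (lie_manifold G) i) (lsubmx z))
    (chart_inv (atlas A j) (rsubmx z)) : R).
Proof.
apply: smooth_on_local => z0 z0ij; have [l z0l] := atlas_cover A (Phi i j z0).
have [Phic Phis] := act_smooth_into i j.
set e := atlas A l in z0l; set d := atlas A j.
pose U := [set z | dom2 i j z /\ chart_dom e (Phi i j z)].
have Uo : open U.
  by apply: open_preimage_at => //; exact: chart_dom_open.
exists U; split => //.
pose o := Ordinal n0.
(* The derivative of the action along [M] is taken as a partial of the joint function in a variable
   of the second block, hence is smooth in both variables. [DE] identifies it with the slice
   derivative in [conformal_factor_coord]. *)
pose D m := partial (rshift k o) (fun z => chart_map e (Phi i j z) 0 m : R).
have Ds m : smooth_on U (D m).
  have := @smooth_on_component _ _ _ (chart_map e \o Phi i j) U m Uo (Phis l).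
  exact: smooth_on_partial.
pose ge m m' (x : M) := g x (coord_vector l m x) (coord_vector l m' x).
pose gd (x : M) := g x (coord_vector j o x) (coord_vector j o x).
pose Q z := (\sum_m \sum_m' ge m m' (Phi i j z) * D m z * D m' z) *
  (gd (chart_inv d (rsubmx z)))^-1.
apply: (@eq_smooth_on _ _ _ U Q) => // [z [[zi zj] zl]|].
  have [dz dzK] := chart_imgP _ _ zj.
  rewrite (conformal_factor_coord g _ _ j l o _ (conformal_act_diffeomorphism _)
    (factor_pullback _) dz zl) -/(Phi i j z) -/e -/d dzK.
  rewrite /Q /gd /ge; congr (_ / _); apply: eq_bigr => m _; apply: eq_bigr => m' _.
  have DE p : partial o (fun y => chart_map e (act (chart_inv
      (atlas (lie_manifold G) i) (lsubmx z)) (chart_inv d y)) 0 p : R) (rsubmx z) =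
      D p z.
    rewrite /D -{3}[z]hsubmxK -partial_slicer; congr partial.
    by apply/funext => y; rewrite /Phi row_mxKl row_mxKr.
  by rewrite !DE.
have Phi_into : smooth_into A U (Phi i j).
  split=> [z [/Phic]//|m]; apply: smooth_on_sub (Phis m) => z [[? _] ?]; by split.
apply: smooth_onM => //.
  apply: smooth_on_sum => // m; apply: smooth_on_sum => // m'.
  apply: smooth_onM => //; apply: smooth_onM => //.
  have UE z : U z -> chart_dom e (Phi i j z) by case.
  exact: (@smooth_into_comp _ _ _ A _ U _ (ge m m') (Phi i j) Uo
    (@chart_dom_open _ _ _ e) Phi_into (metric_smooth g m m') UE).
apply: smooth_onV => //.
  have := smooth_on_comp_rsubmx i j gd _ (@chart_dom_open _ _ _ d)
    (metric_smooth g o o).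
  apply: smooth_on_sub => z [zij _]; split => //.
  by have [] := chart_imgP _ _ zij.2.
move=> z [[_ zj] _]; rewrite gt_eqF//; apply: metric_coord_gt0.
by have [] := chart_imgP _ _ zj.
Qed.

Lemma ln_lambda_jointly_smooth i : jointly_smooth A
  (chart_img (atlas (lie_manifold G) i))
  (fun b x => ln (lambda_Conf act g (chart_inv (atlas (lie_manifold G) i) b) x)).
Proof.
move=> j; rewrite -/(dom2 i j).
set c := atlas (lie_manifold G) i.
have [invc invs] := lie_inv_smooth G.
apply: smooth_on_ln => //; last by move=> z _; exact: lambda_Conf_gt0.
rewrite (_ : (fun z => _) = fun z : 'rV[R]_(k + n) =>
    (u ((chart_inv c (lsubmx z))^-1)%g
      (chart_inv (atlas A j) (rsubmx z)))^-1); last first.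
  by apply/funext => z; exact: lambda_ConfE.
apply: smooth_onV => //; last by move=> z _; rewrite gt_eqF// factor_gt0.
apply: smooth_on_local => z0 z0ij.
have [i' z0i'] := atlas_cover (lie_manifold G) (chart_inv c (lsubmx z0))^-1%g.
set c' := atlas (lie_manifold G) i' in z0i'.
pose V := [set y | chart_img c y /\ chart_dom c' (chart_inv c y)^-1%g].
have Vo : open V.
  apply: (open_chart c [set y | chart_dom c' (y^-1)%g]).
  by move/continuousP: invc; apply; exact: chart_dom_open.
pose U := [set z : 'rV[R]_(k + n) | V (lsubmx z) /\ chart_img (atlas A j) (rsubmx z)].
have Uo : open U by apply: open_prod => //; exact: chart_img_open.
exists U; split; first by case: z0ij.
pose nu y := chart_map c' (chart_inv c y)^-1%g.
(* [psi] inverts the group variable, from chart [c] to chart [c'], and keeps the point of [M]. The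
   claim is localized because [c'] only covers inverses of nearby elements. *)
pose psi (z : 'rV[R]_(k + n)) := row_mx (nu (lsubmx z)) (rsubmx z).
apply: (@eq_smooth_on _ _ _ U ((fun z => u (chart_inv c' (lsubmx z))
    (chart_inv (atlas A j) (rsubmx z))) \o psi)) => //.
  by move=> z [[_ zc'] _]; rewrite /= row_mxKl row_mxKr chart_mapK.
apply: (smooth_on_comp _ _ _ _ Uo (dom2_open i' j) (factor_jointly_smooth i' j)).
- move=> l; case: (splitP l) => m lm.
    have -> : l = lshift n m by exact/val_inj.
    apply: (@eq_smooth_on _ _ _ U ((fun y => nu y 0 m) \o lsubmx)) => //.
      by move=> z _; rewrite /psi row_mxEl.
    apply: (smooth_on_comp _ V _ _ Uo Vo).
    + exact: (@smooth_on_component _ _ _ nu V m Vo (invs i i')).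
    + by move=> p; exact: smooth_on_lsubmx.
    + by move=> z [].
  have -> : l = rshift k m by exact/val_inj.
  apply: (@eq_smooth_on _ _ _ U (fun z => rsubmx z 0 m)) => //.
    by move=> z _; rewrite row_mxEr.
  exact: smooth_on_rsubmx.
- move=> z [[zc zc'] zj]; rewrite /dom2 /= row_mxKl row_mxKr; split => //.
  exact: chart_map_img.
Qed.

Lemma lambda_Conf_cocycle : cocycle A act (lambda_Conf act g).
Proof.
split=> [a||a b x].
- by split; [exact: lambda_Conf_smooth|exact: lambda_Conf_gt0].
- have Ls a : smooth_pred A (fun x => ln (lambda_Conf act g a x)).
    apply/asboolP; apply: (smooth_fun_on_ln A _ _ openT (lambda_Conf_smooth a)).
    by move=> x _; exact: lambda_Conf_gt0.
  exists (fun a => MkCinfty (Ls a)); split=> [a x|i /=].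
    by rewrite /= lnK// posrE; exact: lambda_Conf_gt0.
  exact: (smooth_on_Cinfty A _ (@chart_img_open _ _ _ _) _ _
    (ln_lambda_jointly_smooth i)).
- have [_ actM _ _ _] := hG.
  by rewrite /lambda_Conf -!/(u _) factorM invgM actM actKV mulrC.
Qed.

End ConformalCocycle.

(** * Conformal changes of the metric *)

Section Cohomology.
Context {R : realType} {n k : nat} {M : topologicalType} {A : manifold R n M}.
Context {G : lieGroup R k} {act : G -> M -> M}.

Lemma pos_smoothM (v w : M -> R) : pos_smooth A v -> pos_smooth A w ->
  pos_smooth A (fun x => v x * w x).
Proof.
move=> [vs v0] [ws w0]; split=> [|x]; last exact: mulr_gt0.
exact: smooth_fun_onM openT vs ws.
Qed.

Lemma pos_smoothV (v : M -> R) : pos_smooth A v -> pos_smooth A (fun x => (v x)^-1).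
Proof.
move=> [vs v0]; split=> [|x]; last by rewrite invr_gt0.
by apply: (smooth_fun_onV A _ _ openT vs) => x _; rewrite gt_eqF.
Qed.

Lemma pos_smooth_comp (alpha : M -> M) (v : M -> R) : smooth_map A A alpha ->
  pos_smooth A v -> pos_smooth A (v \o alpha).
Proof.
move=> asm [vs v0]; split=> [|x]; last exact: v0.
exact: smooth_fun_on_comp openT asm vs.
Qed.

Lemma coboundaryM (l l' : G -> M -> R) : coboundary A act l -> coboundary A act l' ->
  coboundary A act (fun a x => l a x * l' a x).
Proof.
move=> [v [vs lE]] [w [ws lE']]; exists (fun x => v x * w x).
by split=> [|a x]; [exact: pos_smoothM|rewrite lE lE' invfM; ring].
Qed.

Lemma coboundaryV (l : G -> M -> R) : coboundary A act l ->
  coboundary A act (fun a x => (l a x)^-1).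
Proof.
move=> [v [vs lE]]; exists (fun x => (v x)^-1).
by split=> [|a x]; [exact: pos_smoothV|rewrite lE invfM invrK mulrC].
Qed.

Lemma coboundary1 : coboundary A act (fun _ _ => 1).
Proof.
exists (fun=> 1); split=> [|a x]; last by rewrite divr1.
by split=> // ; exact: smooth_fun_on_cst openT.
Qed.

Lemma eq_cohomology_class (l l' : G -> M -> R) :
  (forall a x, 0 < l a x) -> (forall a x, 0 < l' a x) ->
  coboundary A act (fun a x => l a x / l' a x) ->
  cohomology_class A act l = cohomology_class A act l'.
Proof.
move=> l0 l0' ll'; apply/seteqP; split=> m [mc ml]; split=> //.
  have -> : (fun a x => m a x / l' a x) =
      fun a x => m a x / l a x * (l a x / l' a x).
    by apply/funext => a; apply/funext => x; rewrite mulrA divfK// gt_eqF.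
  exact: coboundaryM.
have -> : (fun a x => m a x / l a x) =
    fun a x => m a x / l' a x * (l a x / l' a x)^-1.
  by apply/funext => a; apply/funext => x; rewrite invf_div mulrA divfK// gt_eqF.
by apply: coboundaryM => //; exact: coboundaryV.
Qed.

End Cohomology.

Section ConformalChange.
Context {R : realType} {n k : nat} {M : topologicalType} {A : manifold R n M}.
Context {G : lieGroup R k} {act : G -> M -> M} {g g' : riemannian_metric A}.
Variable v : M -> R.
Hypothesis n0 : (0 < n)%N.
Hypothesis vs : pos_smooth A v.
Hypothesis g'E : forall x w w', tangent A x w -> tangent A x w' ->
  g' x w w' = v x * g x w w'.

Lemma pullback_scales_conformal (alpha : M -> M) (u : M -> R) :
  diffeomorphism A alpha -> pullback_scales g alpha u ->
  pullback_scales g' alpha (fun x => v (alpha x) * u x / v x).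
Proof.
move=> da ua x w w' wt wt'.
rewrite g'E; [|exact: tangent_pushforward..].
rewrite ua// g'E// mulrA.
by rewrite [_ / _ * (_ * _)]mulrA divfK// gt_eqF// vs.2.
Qed.

Lemma conformal_automorphism_conformal (alpha : M -> M) :
  conformal_automorphism g alpha -> conformal_automorphism g' alpha.
Proof.
move=> [da [u [us ua]]]; split=> //; exists (fun x => v (alpha x) * u x / v x).
split; last exact: pullback_scales_conformal.
apply: pos_smoothM; last exact: pos_smoothV.
by apply: pos_smoothM => //; apply: pos_smooth_comp => //; case: da => ? [].
Qed.

Hypothesis hG : conformal_lie_subgroup act g.

Lemma conformal_lie_subgroup_conformal : conformal_lie_subgroup act g'.
Proof.
have [act1 actM acti acts actg] := hG; split=> // a.
exact: conformal_automorphism_conformal.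
Qed.

Lemma conformal_factor_conformal a x : conformal_factor g' (act a) x =
  v (act a x) * conformal_factor g (act a) x / v x.
Proof.
have ga := conformal_act hG a.
suff -> : conformal_factor g' (act a) =
  fun x => v (act a x) * conformal_factor g (act a) x / v x by [].
apply: (conformal_factorE g' n0); first exact: conformal_automorphism_conformal.
apply: pullback_scales_conformal; first by case: ga.
exact: (conformal_factorP g _ ga).2.
Qed.

Lemma lambda_Conf_conformal a x : lambda_Conf act g' a x =
  lambda_Conf act g a x * (v x / v (act (a^-1)%g x)).
Proof.
rewrite /lambda_Conf conformal_factor_conformal (actKV hG) mulrA.
by rewrite [v x * _]mulrC.
Qed.

Lemma mu_Conf_conformal : mu_Conf act g' = mu_Conf act g.
Proof.
have l0 a x := lambda_Conf_gt0 n0 hG a x.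
have l0' a x := lambda_Conf_gt0 n0 conformal_lie_subgroup_conformal a x.
apply: eq_cohomology_class => //; exists (fun x => (v x)^-1); split.
  exact: pos_smoothV.
move=> a x; rewrite lambda_Conf_conformal invrK mulrAC divff ?mul1r 1?mulrC//.
by rewrite gt_eqF.
Qed.

End ConformalChange.

Theorem proposition27 (R : realType) (n : nat) (hn : (0 < n)%N)
    (M : topologicalType) (A : manifold R n M) (g : riemannian_metric A)
    (k : nat) (G : lieGroup R k) (act : G -> M -> M)
    (hG : conformal_lie_subgroup act g) :
  (cocycle A act (lambda_Conf act g) /\
   forall g' : riemannian_metric A, conformal_to g' g ->
     conformal_lie_subgroup act g' /\ mu_Conf act g' = mu_Conf act g) /\
  (mu_Conf act g = trivial_class A act <->
   exists h : riemannian_metric A,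
     conformal_to h g /\ forall a : G, riemannian_isometry h (act a)).
Proof.
have cocyc := lambda_Conf_cocycle hn hG.
have l0 a x := lambda_Conf_gt0 hn hG a x.
split; first split=> // g' [v [vs g'E]].
  split; first exact: conformal_lie_subgroup_conformal vs g'E hG.
  exact: mu_Conf_conformal hn vs g'E hG.
split=> [mu1|[h [[v [vs hE]] hiso]]].
  (* Equality of classes is equality of sets, so it is exploited through the representative:
     [lambda_Conf] lies in its own class, hence in that of 1. *)
  have : mu_Conf act g (lambda_Conf act g).
    split=> //; rewrite (_ : (fun a x => _) = fun _ _ => 1); first exact: coboundary1.
    by apply/funext => a; apply/funext => x; rewrite divff// gt_eqF.
  rewrite mu1 => -[_ [v [vs lE]]].
  have [h hE] := metric_scale g v vs.
  exists h; split=> [|a]; first by exists v.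
  split=> [|x w w' wt wt']; first exact: conformal_act_diffeomorphism hG a.
  have ha : pullback_scales h (act a)
      (fun x => v (act a x) * conformal_factor g (act a) x / v x).
    apply: (pullback_scales_conformal v vs (fun x w w' _ _ => hE x w w')).
      exact: conformal_act_diffeomorphism hG a.
    exact: factor_pullback hG a.
  rewrite ha//; congr (_ * _).
  (* At the point [act a x] the coboundary equation expresses the factor of [g] at [x] as
     [v x / v (act a x)], which cancels the factor of [h] to 1. *)
  have := lE a (act a x); rewrite /lambda_Conf (actVK hG) divr1 => ->.
  rewrite mulrCA divff ?mulr1 ?divff// gt_eqF//; exact: vs.2.
apply: eq_cohomology_class => //; exists v; split=> // a x.
rewrite divr1; set y := act (a^-1)%g x.
have ha : pullback_scales h (act a)
    (fun x => v (act a x) * conformal_factor g (act a) x / v x).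
  apply: (pullback_scales_conformal v vs hE).
    exact: conformal_act_diffeomorphism hG a.
  exact: factor_pullback hG a.
(* The factor of [h] is 1 by the isometry hypothesis and is also given by [ha]; uniqueness equates
   the two, and the equality is read at [y], where [lambda_Conf] evaluates the factor of [g]. *)
have /(congr1 (fun f => f y)) := pullback_scales_unique h hn _ _ _ ha (hiso a).2.
rewrite /y (actKV hG) -/y => /(canRL (mulfVK _)); rewrite gt_eqF ?vs.2// => /(_ isT).
rewrite mul1r => <-; rewrite mulrAC divff ?mul1r// gt_eqF//; exact: vs.2.
Qed.
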